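(* Let $\nu=(\nu_1,\dots,\nu_m)$ be a shape with $\{\nu_1,\dots,\nu_m\}=\{1,\dots,d\}$ (so $d=\max(\nu_1,\dots,\nu_m)$). 1. The axis paths variety $\mathcal{A}_{\nu,3}$ is toric whenever $d\le2$. 2. The axis paths variety $\mathcal{A}_{\nu,2}$ is toric whenever $d\le3$. 3. For every $d$ and every $j\in\{1,\dots,d-1\}$, the axis paths variety $\mathcal{A}_{(1,2,\dots,d,j),2}$ is toric.
   Context: For a piecewise smooth path $X:[0,1]\to\mathbb{R}^d$, its $k$-th signature $\sigma^{(k)}(X)\in(\mathbb{R}^d)^{\otimes k}$ has $(i_1\dots i_k)$-th entry $\int_0^1\int_0^{t_k}\cdots\int_0^{t_2}\dot X_{i_1}(t_1)\cdots\dot X_{i_k}(t_k)\,dt_1\cdots dt_k$. The axis-parallel path of shape $\nu=(\nu_1,\dots,\nu_m)$ and sequence of lengths $a=(a_1,\dots,a_m)\in\mathbb{R}^m$ is the piecewise linear path obtained by concatenating, in this order, the linear steps $a_1e_{\nu_1},\dots,a_me_{\nu_m}$, where $e_1,\dots,e_d$ is the standard basis of $\mathbb{R}^d$. Let $g_{\nu,k}:\mathbb{R}^m\to(\mathbb{R}^d)^{\otimes k}$ be the polynomial map sending $a$ to the $k$-th signature of this path. The axis paths variety $\mathcal{A}_{\nu,k}$ is the Zariski closure of the image of $\mathbb{R}^m\xrightarrow{g_{\nu,k}}(\mathbb{R}^d)^{\otimes k}\to(\mathbb{C}^d)^{\otimes k}\dashrightarrow\mathbb{P}^{d^k-1}$.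 A projective variety is called toric here if, after a linear change of coordinates of the ambient projective space, it is the closure of the image of a monomial map (equivalently, its homogeneous prime ideal is generated by binomials, possibly together with variables); it is not required to be normal. *)

(* Defs.v *)
From HB Require Import structures.
From mathcomp Require Import all_boot all_order all_algebra.
From mathcomp Require Import all_classical all_reals all_analysis.
From mathcomp Require Import complex.
(* The notations of mpoly clash with those of mathcomp-analysis. *)
From mathcomp Require Import -(notations) mpoly.

Set Implicit Arguments.
Unset Strict Implicit.
Unset Printing Implicit Defensive.

Import Order.TTheory GRing.Theory Num.Theory.
Import numFieldNormedType.Exports.

Local Open Scope classical_set_scope.
Local Open Scope ring_scope.

(* Indices are 0-based: 'I_d stands for {1, ..., d}. *)

(* int_0^T int_0^{t_k} ... int_0^{t_2} X'_{i_1}(t_1) ... X'_{i_k}(t_k) * c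
   dt_1 ... dt_k, where rw = [:: i_k; ...; i_1] lists the letters outermost
   first and c accumulates the factors X'_{i_j}(t_j) of the enclosing
   integrals. Where X_i is not differentiable, derive1 has an arbitrary real
   value; for a piecewise smooth path this happens only at finitely many
   points. *)
Fixpoint iterated_integral (R : realType) (d : nat) (X : R -> 'rV[R]_d)
    (rw : seq 'I_d) (T c : R) : R :=
  if rw is i :: rw' then
    \int[@lebesgue_measure R]_(t in `[0, T])
       iterated_integral X rw' t (derive1 (fun s => X s ord0 i) t * c)
  else c.

Definition signature (R : realType) (d k : nat) (X : R -> 'rV[R]_d)
    (w : k.-tuple 'I_d) : R :=
  iterated_integral X (rev w) 1 1.

(* The step a_i e_(nu_i) is run through at constant speed on the time interval
   [i/m, (i+1)/m]: the clamped factor is 0 before it, 1 after it. *)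
Definition axis_path (R : realType) (d m : nat) (nu : m.-tuple 'I_d)
    (a : 'rV[R]_m) (t : R) : 'rV[R]_d :=
  \sum_(i < m) (Num.max 0 (Num.min 1 (m%:R * t - i%:R)) * a ord0 i)
                 *: delta_mx ord0 (tnth nu i).

(* The k-th tensor power of the d-dimensional space, in coordinates indexed by
   the d ^ k words of length k. *)
Notation tensor_dim d k := #|{: k.-tuple 'I_d}|.

Definition axis_signature (R : realType) (d m k : nat) (nu : m.-tuple 'I_d)
    (a : 'rV[R]_m) : 'rV[R]_(tensor_dim d k) :=
  \row_j signature (axis_path nu a) (enum_val j).

(* A subset of the projective space P^(N-1) is represented by the set of all
   homogeneous coordinate vectors (nonzero vectors of K^N) of its points.
   [proj_closure S] is the Zariski closure in P^(N-1) of the set of points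
   [u], for u a nonzero element of S. *)
Definition proj_closure (K : fieldType) (N : nat) (S : set 'rV[K]_N) :
    set 'rV[K]_N :=
  [set v : 'rV[K]_N | v != 0 /\
    forall (e : nat) (f : mpoly N K),
      f \is ishomog1 e mdeg ->
      (forall u, S u -> u != 0 -> meval (u ord0) f = 0) ->
      meval (v ord0) f = 0].

Definition axis_variety (R : realType) (d m : nat) (nu : m.-tuple 'I_d)
    (k : nat) : set 'rV[R[i]]_(tensor_dim d k) :=
  proj_closure
    (range (fun a : 'rV[R]_m => map_mx (real_complex R) (axis_signature k nu a))).

Arguments axis_variety R {d m} nu k.

(* The monomial with exponent vector [row j alpha] in coordinate j if j \in J,
   and 0 in the other coordinates (these correspond to the variables that may
   occur among the generators of a toric ideal). *)
Definition monomial_map (K : fieldType) (N s : nat) (J : {set 'I_N})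
    (alpha : 'M[int]_(N, s)) (t : 'rV[K]_s) : 'rV[K]_N :=
  \row_j (if j \in J then \prod_(l < s) t ord0 l ^ alpha j l else 0).

Definition toric (K : fieldType) (N : nat) (X : set 'rV[K]_N) : Prop :=
  exists (s : nat) (J : {set 'I_N}) (alpha : 'M[int]_(N, s)) (A : 'M[K]_N),
    [/\ (0 < #|J|)%N, A \in unitmx &
        X = mulmxr A @`
              proj_closure (monomial_map J alpha @`
                              [set t : 'rV[K]_s | forall l, t ord0 l != 0])].

(* Main.v *)
Require Import Defs.
From mathcomp Require Import all_boot all_order all_algebra.
From mathcomp Require Import all_classical all_reals all_analysis.
From mathcomp Require Import measurable_realfun.
From mathcomp Require Import complex.
From mathcomp Require Import -(notations) mpoly.
From mathcomp Require Import ring lra.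

Set Implicit Arguments.
Unset Strict Implicit.
Unset Printing Implicit Defensive.

Import Order.TTheory GRing.Theory Num.Theory.
Import numFieldNormedType.Exports.

Local Open Scope ring_scope.

(** By Chen's identity the signature of an axis path is a polynomial in the
    lengths of its steps, and the claim is that a linear change of coordinates
    turns it into a vector of monomials in some parameters that can be chosen
    freely. The Zariski closure of the image is then the closure of the image of
    a torus under a monomial map ([toric_of_monomials]).

    At level 2 the shuffle relation says that the entries [ij] and [ji] add up
    to [x_i x_j], where [x] is the endpoint of the path. After adding entries in
    pairs only one entry for each pair of letters remains, and [toric_order2]
    asks that it be 0 or a monomial. For the word [1 2 .. d j] these entries are
    0 or [x_i b], with [b] the length of the last step. For three letters [a],
    [b], [c] there are three of them, and the shape of the path decides
    ([shapes3]). An entry is 0 if its two letters never occur in the given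
    order. If [a] is only at the ends of the word, the entries [ba] and [ca] are
    [x_b u] and [x_c u] with [u] the length of the final steps
    ([outer_letter]). If [b] is only in the middle, between two parts without
    [c] before [a], the entries are products of the lengths [x_b], [u], [v]
    ([pivot_letter]). In all other cases the entries that are not 0 are
    algebraically independent of each other and of [x]. That the list of cases
    is complete is a statement about words and their subsequences, which a
    finite automaton verifies ([classify]).

    At level 3 in two letters, the third signature has eight entries. In
    suitable coordinates these are the four cubic monomials in the endpoint
    [(x, y)], the products [p x] and [p y] with the lower entry [p] of level 2,
    and two more coordinates [q] and [r] ([toric_binary3]). If the word has at
    least five blocks, then [x], [y], [p], [q], [r] are independent; if it has
    fewer, then [p], [q], [r] are [u v], [u v v], [u u v] for two lengths [u] and [v]
    ([alternating4]), or all 0.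

    Independence is proved by solving for the step lengths: the parameters that
    come from real lengths form a set on which no nonzero polynomial vanishes,
    for which it suffices that one variable after the other can take infinitely
    many values ([thick], [polyfun_vanish]). Only the short subsequence that
    defines the case is needed for this, as all other lengths can be 0
    ([sig_pad]).

    It remains to compute the iterated integrals: the velocity of an axis path
    is piecewise constant, so this is the fundamental theorem of calculus on
    each piece ([integral_piecewise], [axis_path_integral]). *)

(** * Integrals of piecewise polynomial functions *)

Section Integration.
Local Open Scope classical_set_scope.
Variable R : realType.
Local Notation mu := (@lebesgue_measure R).

(** The values at the endpoints form a null set, so the fundamental theorem
    of calculus applies even though the derivative of an axis path is arbitrary
    at the corners. The left end is excluded so that consecutive pieces are
    disjoint. *)
Lemma integral_open_piece (f F : R -> R) (q : {poly R}) (a b : R) : a <= b ->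
    (forall t, a <= t <= b -> F t = q.[t]) ->
    (forall t, a < t < b -> f t = q^`().[t]) ->
  measurable_fun `]a, b] f /\
  (\int[mu]_(t in `]a, b]) (f t)%:E = (F b - F a)%:E)%E.
Proof.
rewrite le_eqVlt => /predU1P[<-|ab] Fq fq.
  rewrite set_itv_ge ?bnd_simp// subrr integral_set0.
  by split=> //; exact: measurable_fun_set0.
have mf : measurable_fun `]a, b[ f.
  apply: (eq_measurable_fun (horner q^`())); last exact: measurable_poly.
  by move=> t; rewrite inE/= in_itv/= => /fq.
split; first by apply/measurable_fun_itv_bndo_bndcP.
rewrite -integral_itv_bndo_bndc; last exact/measurable_EFinP.
transitivity (\int[mu]_(t in `]a, b[) (q^`().[t])%:E)%E.
  by apply: eq_integral => t; rewrite inE/= in_itv/= => /fq ->.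
have mq (A : set R) : measurable_fun A (EFin \o horner q^`()).
  by apply/measurable_EFinP; exact: measurable_poly.
rewrite integral_itv_bndo_bndc// integral_itv_obnd_cbnd//.
rewrite (@continuous_FTC2 _ _ (horner q))//.
- by rewrite !Fq ?lexx ?(ltW ab)// EFinB.
- by apply: continuous_subspaceT => x; exact: continuous_horner.
- split; first by move=> x _; exact: derivable_horner.
  + by apply: cvg_at_right_filter; exact: continuous_horner.
  + by apply: cvg_at_left_filter; exact: continuous_horner.
- by move=> x _; rewrite derivE.
Qed.

(** Adding up the pieces: [F] is automatically continuous at the breakpoints,
    because its polynomial expressions hold on closed intervals that share
    their endpoints. *)
Lemma integral_piecewise (m : nat) (f F : R -> R) : (0 < m)%N ->
    (forall j : nat, (j < m)%N -> exists q : {poly R},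
       (forall t, j%:R / m%:R <= t <= j.+1%:R / m%:R -> F t = q.[t]) /\
       (forall t, j%:R / m%:R < t < j.+1%:R / m%:R -> f t = q^`().[t])) ->
  forall T : R, 0 <= T <= 1 -> \int[mu]_(t in `[0, T]) f t = F T - F 0.
Proof.
move=> m0 pw.
have m0' : 0 < m%:R :> R by rewrite ltr0n.
suff H j : (j <= m)%N -> forall T : R, 0 <= T <= j%:R / m%:R ->
    measurable_fun `[0, T] f /\
    (\int[mu]_(t in `[0%R, T]) (f t)%:E = (F T - F 0)%:E)%E.
  move=> T T01; rewrite /Rintegral.
  by have [|_ ->] := H m (leqnn m) T; rewrite // divff// gt_eqF.
elim: j => [_ T|j IH jm T].
  rewrite mul0r -eq_le => /eqP <-; rewrite set_itv1 subrr integral_set1.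
  by split=> //; exact: measurable_fun_set1.
move=> /andP[T0 Tj].
have [TT|jT] := leP T (j%:R / m%:R); first by apply: IH (ltnW jm) _ _; rewrite T0.
set s := j%:R / m%:R in jT.
have s0 : 0 <= s by rewrite divr_ge0// ltW.
have [mf1 If1] := IH (ltnW jm) s (introT andP (conj s0 (lexx _))).
have [q [Fq fq]] := pw j jm.
have [||mf2 If2] := @integral_open_piece f F q s T (ltW jT).
- by move=> t /andP[st tT]; apply: Fq; rewrite st (le_trans tT).
- by move=> t /andP[st tT]; apply: fq; rewrite st (lt_le_trans tT).
have Eu : `[0, T] = `[0, s] `|` `]s, T].
  by apply: itv_bndbnd_setU; rewrite bnd_simp// ltW.
have mf : measurable_fun `[0, T] f by rewrite Eu measurable_funU.
split=> //; rewrite Eu integral_setU//.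
- by rewrite If1 If2 -EFinD; congr (_%:E); ring.
- by rewrite -Eu; apply/measurable_EFinP.
- apply/disj_setPS => y [/=]; rewrite 2!in_itv/= => /andP[_ yx] /andP[].
  by rewrite ltNge yx.
Qed.
End Integration.

(** * The signature of an axis path as a polynomial in the step lengths *)

Definition hornerexpE := (@hornerD, @hornerM, hornerC, hornerX, horner_exp,
  @hornerMn, @hornerN, horner0).

Section WordSignature.
Variables (R : realType) (I : eqType).
Implicit Types (s : seq (I * R)) (i j k y : I) (r : R).

(** The recursions are Chen's identity for the product of the tensor
    exponentials of the steps: the first step contributes [r ^ n / n!] times the
    word made of [n] copies of its own letter. A path is a list of pairs
    (letter, length). *)
Fixpoint sig1 s i : R :=
  if s is (y, r) :: s' then sig1 s' i + (y == i)%:R * r else 0.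

Fixpoint sig2 s i j : R :=
  if s is (y, r) :: s' then
    sig2 s' i j + (y == i)%:R * r * sig1 s' j
    + (y == i)%:R * (y == j)%:R * (r ^+ 2 / 2)
  else 0.

Fixpoint sig3 s i j k : R :=
  if s is (y, r) :: s' then
    sig3 s' i j k + (y == i)%:R * r * sig2 s' j k
    + (y == i)%:R * (y == j)%:R * (r ^+ 2 / 2) * sig1 s' k
    + (y == i)%:R * (y == j)%:R * (y == k)%:R * (r ^+ 3 / 6)
  else 0.

(** Chen's identity for concatenated paths, up to level 3. *)
Lemma sig1_cat s t i : sig1 (s ++ t) i = sig1 s i + sig1 t i.
Proof. by elim: s => [|[y r] s IH] /=; [ring | rewrite IH; ring]. Qed.

Lemma sig2_cat s t i j :
  sig2 (s ++ t) i j = sig2 s i j + sig1 s i * sig1 t j + sig2 t i j.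
Proof.
by elim: s => [|[y r] s IH] /=; [ring | rewrite IH sig1_cat; ring].
Qed.

Lemma sig3_cat s t i j k :
  sig3 (s ++ t) i j k =
  sig3 s i j k + sig2 s i j * sig1 t k + sig1 s i * sig2 t j k + sig3 t i j k.
Proof.
by elim: s => [|[y r] s IH] /=; [ring | rewrite IH sig1_cat sig2_cat; ring].
Qed.

Lemma sig1_sum s i : sig1 s i = \sum_(p <- s) (p.1 == i)%:R * p.2.
Proof.
elim: s => [|[y r] s IH] /=; first by rewrite big_nil.
by rewrite big_cons IH addrC.
Qed.

Definition zeros (w : seq I) : seq (I * R) := [seq (y, 0) | y <- w].

Lemma sig1_zeros w i : sig1 (zeros w) i = 0.
Proof. by elim: w => //= y w ->; ring. Qed.

Lemma sig2_zeros w i j : sig2 (zeros w) i j = 0.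
Proof. by elim: w => //= y w ->; ring. Qed.

Lemma sig3_zeros w i j k : sig3 (zeros w) i j k = 0.
Proof. by elim: w => //= y w ->; ring. Qed.

(** The differential equation of iterated integrals, for a path whose last
    step has variable length [r]: lengthening that step in direction [i]
    changes [G] at the rate [G']. The conditions on [zeros] allow the steps that
    have not been reached yet to be present with length 0. *)
Definition steps_to (G G' : seq (I * R) -> R) i :=
  [/\ forall w, G (zeros w) = 0,
      forall s w, G (s ++ zeros w) = G s,
      forall s w, G' (s ++ zeros w) = G' s &
      forall s y, exists q : {poly R}, forall r,
        G (rcons s (y, r)) = q.[r] /\
        (y == i)%:R * G' (rcons s (y, r)) = q^`().[r]].

Lemma sig1_step i : steps_to (sig1^~ i) (fun=> 1) i.
Proof.
split=> [w|s w|s w|s y]; rewrite ?sig1_cat ?sig1_zeros ?addr0//.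
exists ((sig1 s i)%:P + (y == i)%:R%:P * 'X) => r.
by rewrite -cats1 sig1_cat /= !poly.derivE !hornerexpE; split; ring.
Qed.

Lemma sig2_step i j : steps_to (fun s => sig2 s i j) (sig1^~ i) j.
Proof.
split=> [w|s w|s w|s y];
  rewrite ?(sig2_cat, sig1_cat, sig2_zeros, sig1_zeros) ?mulr0 ?addr0//.
exists ((sig2 s i j)%:P + (sig1 s i * (y == j)%:R)%:P * 'X
        + ((y == i)%:R * (y == j)%:R / 2)%:P * 'X ^+ 2) => r.
rewrite -cats1 sig2_cat sig1_cat /= !poly.derivE !hornerexpE; split; by field.
Qed.

Lemma sig3_step i j k : steps_to (fun s => sig3 s i j k) (fun s => sig2 s i j) k.
Proof.
split=> [w|s w|s w|s y];
  rewrite ?(sig3_cat, sig2_cat, sig1_cat, sig3_zeros, sig2_zeros, sig1_zeros)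
          ?mulr0 ?addr0//.
exists ((sig3 s i j k)%:P + (sig2 s i j * (y == k)%:R)%:P * 'X
        + (sig1 s i * (y == j)%:R * (y == k)%:R / 2)%:P * 'X ^+ 2
        + ((y == i)%:R * (y == j)%:R * (y == k)%:R / 6)%:P * 'X ^+ 3) => r.
rewrite -cats1 sig3_cat sig2_cat /= !poly.derivE !hornerexpE; split; by field.
Qed.

End WordSignature.

Section AxisPath.
Variables (R : realType) (d m : nat) (nu : m.-tuple 'I_d) (a : 'rV[R]_m).
Hypothesis m_gt0 : (0 < m)%N.

Definition clamp01 (x : R) : R := Num.max 0 (Num.min 1 x).

(** The steps of the part of the path that is run through up to time [t]. *)
Definition trunc (t : R) : seq ('I_d * R) :=
  [seq (tnth nu p, clamp01 (m%:R * t - p%:R) * a ord0 p) | p <- enum 'I_m].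

Definition steps : seq ('I_d * R) := [seq (tnth nu p, a ord0 p) | p <- enum 'I_m].

Lemma clamp01_le0 x : x <= 0 -> clamp01 x = 0.
Proof.
by move=> x0; rewrite /clamp01 (min_idPr _) ?(max_idPl _)// (le_trans x0).
Qed.

Lemma clamp01_ge1 x : 1 <= x -> clamp01 x = 1.
Proof. by move=> x1; rewrite /clamp01 (min_idPl _)// (max_idPr _). Qed.

Lemma clamp01_id x : 0 <= x <= 1 -> clamp01 x = x.
Proof. by move=> /andP[x0 x1]; rewrite /clamp01 (min_idPr _)// (max_idPr _). Qed.

Let m_gt0' : 0 < m%:R :> R. Proof. by rewrite ltr0n. Qed.

Lemma trunc0 : trunc 0 = zeros R nu.
Proof.
rewrite /zeros -[X in map _ X](map_tnth_enum nu) -map_comp.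
by apply: eq_map => p /=; rewrite clamp01_le0 ?mul0r// mulr0 sub0r oppr_le0.
Qed.

Lemma trunc1 : trunc 1 = steps.
Proof.
apply: eq_map => p /=; rewrite clamp01_ge1 ?mul1r//.
by rewrite mulr1 lerBrDr addrC natr1 ler_nat.
Qed.

Lemma trunc_piece (j : nat) : (j < m)%N -> exists s y b w,
  forall t, j%:R / m%:R <= t <= j.+1%:R / m%:R ->
    trunc t = rcons s (y, (m%:R * t - j%:R) * b) ++ zeros R w.
Proof.
move=> jm; pose j' := Ordinal jm.
exists [seq (tnth nu p, a ord0 p) | p <- take j (enum 'I_m)], (tnth nu j'),
  (a ord0 j'), [seq tnth nu p | p <- drop j.+1 (enum 'I_m)] => t.
rewrite ler_pdivrMr// ler_pdivlMr// [t * _]mulrC => /andP[jt tj].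
rewrite /trunc -{1}(cat_take_drop j (enum 'I_m)) (drop_nth j') ?size_enum_ord//.
have -> : nth j' (enum 'I_m) j = j' by apply: val_inj; rewrite /= nth_enum_ord.
rewrite map_cat /= cat_rcons clamp01_id; last by apply/andP; split; lra.
have mem (p : 'I_m) (s : seq 'I_m) : p \in s -> val p \in map val s.
  by move=> ps; apply: map_f.
congr (_ ++ _ :: _); last rewrite /zeros -map_comp; apply/eq_in_map => p /= /mem.
  rewrite map_take val_enum_ord take_iota mem_iota /= add0n (minn_idPl (ltnW jm)).
  rewrite -(ler_nat R) -natr1 => pj; rewrite clamp01_ge1 ?mul1r//; lra.
rewrite map_drop val_enum_ord drop_iota mem_iota add0n => /andP[+ _].
rewrite -(ler_nat R) => pj; rewrite clamp01_le0 ?mul0r//.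
by move: jt tj; rewrite -natr1 in pj *; lra.
Qed.

Lemma axis_path_sig1 t i : axis_path nu a t ord0 i = sig1 (trunc t) i.
Proof.
rewrite sig1_sum big_map big_enum /axis_path summxE; apply: eq_bigr => p _.
by rewrite !mxE eqxx /= eq_sym mulrC.
Qed.

(** Integrating [G'] against the velocity of the path raises the level of the
    signature by one: on each piece [G] of the truncated path is a polynomial in
    the time whose derivative is the integrand. *)
Lemma axis_path_integral (G G' : seq ('I_d * R) -> R) i T c (f : R -> R) :
    steps_to G G' i -> 0 <= T <= 1 ->
    (forall t, 0 <= t <= 1 -> f t = G' (trunc t) *
        (derive1 (fun u => axis_path nu a u ord0 i) t * c)) ->
  \int[@lebesgue_measure R]_(t in [set` `[0, T]]) f t = G (trunc T) * c.
Proof.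
move=> [Gz Gcat G'cat Gq] T01 fE.
rewrite (@integral_piecewise _ m _ (fun t => G (trunc t) * c)) //;
  first by rewrite trunc0 Gz mul0r subr0.
move=> j jm.
have [s [y [b [w tr]]]] := trunc_piece jm.
have [q qP] := Gq s y.
have [l [lE dlE]] : exists l : {poly R},
    (forall t, l.[t] = (m%:R * t - j%:R) * b) /\ l^`() = (m%:R * b)%:P.
  exists ((m%:R * b)%:P * 'X - (j%:R * b)%:P); split=> [t|].
    by rewrite !hornerexpE; ring.
  by rewrite !poly.derivE subr0 mulr1 ?alg_polyC -?mul_polyC ?mulr1.
exists ((q \Po l) * c%:P); split=> t t_in.
  rewrite tr// Gcat (qP _).1 hornerM hornerC horner_comp lE//.
have t_in' : j%:R / m%:R <= t <= j.+1%:R / m%:R by case/andP: t_in => ? ?; rewrite !ltW.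
have t01 : 0 <= t <= 1.
  case/andP: t_in' => jt tj; rewrite (le_trans _ jt) ?divr_ge0//=.
  by rewrite (le_trans tj)// ler_pdivrMr// mul1r ler_nat.
have dE : derive1 (fun u => axis_path nu a u ord0 i) t = m%:R * b * (y == i)%:R.
  rewrite derive1E; apply: (@derive_val _ _ _ _ _ _ (m%:R * b * (y == i)%:R)).
  pose g : {poly R} := (sig1 s i)%:P + (y == i)%:R%:P * l.
  have -> : m%:R * b * (y == i)%:R = g^`().[t].
    by rewrite /g !poly.derivE dlE !hornerexpE; ring.
  apply: (@near_eq_is_derive _ _ _ (horner g)).
  near=> u.
  have u_in : j%:R / m%:R <= u <= j.+1%:R / m%:R.
    near: u; apply: filterS (near_in_itvoo t_in) => u.
    by rewrite in_itv => /andP[? ?]; rewrite !ltW.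
  rewrite axis_path_sig1 tr// sig1_cat sig1_zeros -cats1 sig1_cat /=.
  by rewrite /g !hornerexpE lE; ring.
rewrite fE// dE tr// G'cat derivM derivC mulr0 addr0 deriv_comp !hornerM hornerC.
by rewrite horner_comp lE -(qP _).2 dlE hornerC; ring.
Unshelve. all: by end_near. Qed.

Lemma iterated_integral1 i T c : 0 <= T <= 1 ->
  iterated_integral (axis_path nu a) [:: i] T c = sig1 (trunc T) i * c.
Proof.
move=> T01; apply: (axis_path_integral (sig1_step _ i)) => // t _ /=.
by rewrite mul1r.
Qed.

Lemma iterated_integral2 i j T c : 0 <= T <= 1 ->
  iterated_integral (axis_path nu a) [:: j; i] T c = sig2 (trunc T) i j * c.
Proof.
move=> T01; apply: (axis_path_integral (sig2_step _ i j)) => // t t01.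
exact: iterated_integral1.
Qed.

Lemma iterated_integral3 i j k T c : 0 <= T <= 1 ->
  iterated_integral (axis_path nu a) [:: k; j; i] T c =
  sig3 (trunc T) i j k * c.
Proof.
move=> T01; apply: (axis_path_integral (sig3_step _ i j k)) => // t t01.
exact: iterated_integral2.
Qed.

Lemma signature2 i j : signature (axis_path nu a) [tuple i; j] = sig2 steps i j.
Proof.
rewrite /signature (_ : rev _ = [:: j; i])// iterated_integral2 ?ler01 ?lexx//.
by rewrite mulr1 trunc1.
Qed.

Lemma signature3 i j k :
  signature (axis_path nu a) [tuple i; j; k] = sig3 steps i j k.
Proof.
rewrite /signature (_ : rev _ = [:: k; j; i])// iterated_integral3 ?ler01 ?lexx//.
by rewrite mulr1 trunc1.
Qed.
End AxisPath.

(** * Zariski density *)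

Section Density.

(** Polynomial functions of a list of variables. Fixing the first variable
    stays in the class, which is what the inductions below use; the length of
    the list is not fixed, missing variables being 0. *)
Inductive polyfun (K : fieldType) : (seq K -> K) -> Prop :=
| polyfun_cst c : polyfun (fun=> c)
| polyfun_coord i : polyfun (fun z => z`_i)
| polyfun_add f g : polyfun f -> polyfun g -> polyfun (fun z => f z + g z)
| polyfun_mul f g : polyfun f -> polyfun g -> polyfun (fun z => f z * g z).

Lemma polyfun_behead (K : fieldType) (f : seq K -> K) x :
  polyfun f -> polyfun (fun z => f (x :: z)).
Proof.
elim=> [c|[|i]|g h _ IHg _ IHh|g h _ IHg _ IHh] /=.
- exact: polyfun_cst.
- exact: polyfun_cst.
- exact: polyfun_coord.
- exact: polyfun_add.
- exact: polyfun_mul.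
Qed.

Lemma polyfun_head (K : fieldType) (f : seq K -> K) z :
  polyfun f -> exists q : {poly K}, forall x, f (x :: z) = q.[x].
Proof.
elim=> [c|[|i]|g h _ [p pE] _ [q qE]|g h _ [p pE] _ [q qE]] /=.
- by exists c%:P => x; rewrite hornerC.
- by exists 'X => x; rewrite hornerX.
- by exists (z`_i)%:P => x; rewrite hornerC.
- by exists (p + q) => x; rewrite hornerD pE qE.
- by exists (p * q) => x; rewrite hornerM pE qE.
Qed.

Lemma polyfun_sum (K : fieldType) (J : Type) (r : seq J) (F : J -> seq K -> K) :
  (forall j, polyfun (F j)) -> polyfun (fun z => \sum_(j <- r) F j z).
Proof.
move=> PF; elim: r => [|j r IH].
  by under eq_fun do rewrite big_nil; exact: polyfun_cst.
by under eq_fun do rewrite big_cons; exact: polyfun_add.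
Qed.

Lemma polyfun_prod (K : fieldType) (J : Type) (r : seq J) (F : J -> seq K -> K) :
  (forall j, polyfun (F j)) -> polyfun (fun z => \prod_(j <- r) F j z).
Proof.
move=> PF; elim: r => [|j r IH].
  by under eq_fun do rewrite big_nil; exact: polyfun_cst.
by under eq_fun do rewrite big_cons; exact: polyfun_mul.
Qed.

Lemma polyfun_exp (K : fieldType) (f : seq K -> K) n :
  polyfun f -> polyfun (fun z => f z ^+ n).
Proof.
move=> Pf; elim: n => [|n IH].
  by under eq_fun do rewrite expr0; exact: polyfun_cst.
by under eq_fun do rewrite exprS; exact: polyfun_mul.
Qed.

Lemma polyfun_meval (K : fieldType) N (F : seq K -> 'I_N -> K) (f : mpoly N K) :
  (forall j, polyfun (F^~ j)) -> polyfun (fun z => meval (F z) f).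
Proof.
move=> PF; under eq_fun do rewrite mevalE.
apply: polyfun_sum => mm; apply: polyfun_mul; first exact: polyfun_cst.
by apply: polyfun_prod => j; exact: polyfun_exp.
Qed.

Variable R : realType.

(** A criterion for Zariski density that can be checked one variable at a
    time: infinitely many values of the first variable leave a thick set of
    values for the others. Infinitude is expressed by avoiding any given finite
    list. *)
Fixpoint thick (s : nat) (S : seq R -> Prop) : Prop :=
  if s is s'.+1 then
    forall bad : seq R, exists2 x, x \notin bad & thick s' (fun P => S (x :: P))
  else S [::].

Lemma thick_sub s (S S' : seq R -> Prop) :
  (forall P, size P = s -> S P -> S' P) -> thick s S -> thick s S'.
Proof.
elim: s S S' => [|s IH] S S' SS' /=; first exact: SS'.
move=> tS bad; have [x xbad tx] := tS bad; exists x => //.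
by apply: IH tx => P sP; apply: SS'; rewrite /= sP.
Qed.

Lemma thick_cofinite s (S : seq R -> Prop) (bad : seq R) :
  (forall x, x \notin bad -> thick s (fun P => S (x :: P))) -> thick s.+1 S.
Proof.
move=> H bad'; set l := bad ++ bad'.
pose x := 1 + \sum_(y <- l) `|y|.
have xl : x \notin l.
  apply/negP => xl; have : `|x| <= \sum_(y <- l) `|y|.
    rewrite (big_rem _ xl) /= lerDl; apply: sumr_ge0 => y _; exact: normr_ge0.
  have x_ge0 : 0 <= x by rewrite addr_ge0// sumr_ge0.
  by rewrite ger0_norm// /x gerDr ler10.
move: xl; rewrite mem_cat negb_or => /andP[xb xb']; exists x => //.
exact: H.
Qed.

Lemma thick_neq0 s : thick s (fun P => forall i, (i < s)%N -> P`_i != 0).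
Proof.
elim: s => [|s IH]; first by [].
apply: (@thick_cofinite _ _ [:: 0]) => x; rewrite inE => x0.
by apply: thick_sub IH => P _ IH [|i] //=; exact: IH.
Qed.

(** Fix the last variables: the resulting univariate polynomial vanishes at
    infinitely many real numbers by induction, so it is 0. Real points thus
    suffice to test complex polynomials. *)
Lemma polyfun_vanish s (S : seq R -> Prop) (f : seq R[i] -> R[i]) :
    polyfun f -> thick s S ->
    (forall P, size P = s -> S P -> f (map (real_complex R) P) = 0) ->
  forall z, size z = s -> f z = 0.
Proof.
elim: s S f => [|s IH] S f Pf tS Sf z.
  by move=> /size0nil->; exact: (Sf [::]).
case: z => // x z [sz]; have [q qE] := polyfun_head z Pf.
suff q0 : q = 0 by rewrite qE q0 horner0.
apply/eqP; apply: contraT => q0.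
have roots n : exists2 l : seq R, size l = n &
    uniq l && all (root q) (map (real_complex R) l).
  elim: n => [|n [l sl /andP[ul rl]]]; first by exists [::].
  have [y yl ty] := tS l.
  exists (y :: l); first by rewrite /= sl.
  rewrite /= yl ul rl !andbT/= /root -qE; apply/eqP.
  apply: (IH _ (fun z => f ((real_complex R y) :: z)) _ ty) => //.
    exact: polyfun_behead.
  by move=> P sP SP; apply: (Sf (y :: P)) => //=; rewrite sP.
have [l sl /andP[ul rl]] := roots (size q).
have := max_poly_roots q0 rl.
rewrite map_inj_uniq; last exact: fmorph_inj.
by rewrite size_map sl ltnn => /(_ ul).
Qed.

End Density.

(** A monomial is the list of the indices of its variables, with
    multiplicity; [None] stands for the coordinate 0. *)
Definition mono (K : pzRingType) (v : seq K) (o : option (seq nat)) : K :=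
  if o is Some r then \prod_(i <- r) v`_i else 0.

Lemma map_mono (K L : pzRingType) (phi : {rmorphism K -> L}) (v : seq K) o :
  mono (map phi v) o = phi (mono v o).
Proof.
case: o => [r|]; rewrite /mono ?rmorph0// rmorph_prod; apply: eq_bigr => i _.
have [iv|vi] := ltnP i (size v); first by rewrite (nth_map 0).
by rewrite !nth_default ?size_map// rmorph0.
Qed.

Lemma prod_count (K : comPzRingType) s (F : nat -> K) (r : seq nat) :
  all (fun i => (i < s)%N) r ->
  \prod_(i <- r) F i = \prod_(l < s) F l ^+ count_mem (l : nat) r.
Proof.
elim: r => [_|i r IH /= /andP[i_s /IH E]].
  by rewrite big_nil big1.
rewrite big_cons E; under [RHS]eq_bigr do rewrite exprD.
rewrite big_split /=; congr (_ * _).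
rewrite (bigD1 (Ordinal i_s)) //= eqxx expr1 big1 ?mulr1// => l.
by rewrite -val_eqE /= eq_sym => /negPf ->.
Qed.

(** * A criterion for toric closures *)

Section LinearSubstitution.
Variables (K : fieldType) (N : nat).

Definition lin_subst (A : 'M[K]_N) (f : mpoly N K) : mpoly N K :=
  comp_mpoly [tuple \sum_(i < N) A i j *: mpolyX K (mnm1 i) | j < N] f.

Lemma meval_lin_subst A f (v : 'rV[K]_N) :
  meval (v ord0) (lin_subst A f) = meval ((v *m A) ord0) f.
Proof.
rewrite /lin_subst comp_mpoly_meval; apply: meval_eq => j.
rewrite tnth_mktuple raddf_sum mxE; apply: eq_bigr => i _.
by rewrite /= mevalZ mevalXU mulrC.
Qed.

Lemma homog_lin_subst A f e :
  f \is ishomog1 e mdeg -> lin_subst A f \is ishomog1 e mdeg.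
Proof.
move=> /dhomogP hf; rewrite /lin_subst comp_mpolyEX big_seq.
apply: rpred_sum => mm /hf dm; apply: dhomogZ; rewrite comp_mpolyX.
have {dm} -> : e = (\sum_(i < N) mm i)%N by rewrite -mdegE -dm.
apply: (big_ind2 (fun (x : mpoly N K) (n : nat) => x \is ishomog1 n mdeg)).
- exact: dhomog1.
- by move=> x n y n'; exact: dhomogM.
move=> j _; rewrite -[X in ishomog1 X _]mul1n; apply: dhomogMn.
rewrite tnth_mktuple; apply: rpred_sum => i _; apply: dhomogZ.
by rewrite dhomogX; apply/eqP; exact: mdeg1.
Qed.
End LinearSubstitution.

(** The criterion: after the invertible linear change [B], every value of [g] is
    a vector of monomials in some parameters [P], and the parameters obtained in
    this way form a thick set. A polynomial then vanishes on the values of [g] if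
    and only if it vanishes on the monomial image of the torus, so that the two
    Zariski closures differ by [B] only. *)
Section ToricCriterion.
Variables (R : realType) (N s : nat) (T : Type) (g : T -> 'rV[R]_N).
Variables (B : 'M[R]_N) (mo : 'I_N -> option (seq nat)).
Hypothesis B_unit : B \in unitmx.
Hypothesis mo_some : exists j, mo j != None.
Hypothesis mo_lt : forall j r, mo j = Some r -> all (fun i => (i < s)%N) r.
Hypothesis g_mono : forall a, exists2 P : seq R, size P = s &
  forall j, (g a *m B) ord0 j = mono P (mo j).
Hypothesis mono_dense :
  thick s (fun P => exists a, forall j, (g a *m B) ord0 j = mono P (mo j)).

Local Notation C := (R[i]).
Local Notation rc := (real_complex R).

Let gC a : 'rV[C]_N := map_mx rc (g a).
Let BC : 'M[C]_N := map_mx rc B.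
Let M (z : seq C) : 'rV[C]_N := \row_j mono z (mo j).
Let torus := [set t : 'rV[C]_s | forall l, t ord0 l != 0]%classic.
Let J := [set j | mo j != None].
Let alpha : 'M[int]_(N, s) :=
  \matrix_(j, l) (count_mem (l : nat) (odflt [::] (mo j)))%:Z.

Let BC_unit : BC \in unitmx. Proof. by rewrite map_unitmx. Qed.

Let monomial_mapE t : monomial_map J alpha t = M [seq t ord0 l | l <- enum 'I_s].
Proof.
apply/rowP => j; rewrite !mxE inE.
case E: (mo j) => [r|]//=; rewrite (prod_count _ (mo_lt E)).
apply: eq_bigr => l _; rewrite mxE E /= (nth_map l) ?size_enum_ord//.
by rewrite nth_ord_enum.
Qed.

Let polyfun_M j : polyfun (fun z => M z ord0 j).
Proof.
under eq_fun do rewrite mxE.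
case: (mo j) => [r|] /=; last exact: polyfun_cst.
by apply: polyfun_prod => i; exact: polyfun_coord.
Qed.

Let gC_mono a P : (forall j, (g a *m B) ord0 j = mono P (mo j)) ->
  gC a = M (map rc P) *m invmx BC.
Proof.
move=> gP; apply: (canRL (mulmxK BC_unit)).
by apply/rowP => j; rewrite -map_mxM [LHS]mxE gP [RHS]mxE map_mono.
Qed.

Let Mn0 z : (forall i, (i < s)%N -> z`_i != 0) -> M z != 0.
Proof.
move=> zn0; have [j] := mo_some; case E: (mo j) => [r|]// _.
apply/eqP => /rowP/(_ j); rewrite !mxE E /= => /eqP.
rewrite prodf_seq_eq0 => /hasP[i ir /=]; apply/negP/zn0.
exact: (allP (mo_lt E)).
Qed.

Let torus_nth (t : 'rV[C]_s) i (i_s : (i < s)%N) :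
  [seq t ord0 l | l <- enum 'I_s]`_i = t ord0 (Ordinal i_s) :> C.
Proof.
rewrite (nth_map (Ordinal i_s)) ?size_enum_ord//; congr (t _ _).
by apply: val_inj; rewrite /= nth_enum_ord.
Qed.

(** The torus is itself thick, which gives one direction. In the other one,
    nothing is known of the polynomial at the points where [g] is 0; there some
    parameter is 0, hence the factor [\prod z`_i] in [h']. *)
Let vanish_iff (f : mpoly N C) :
  (forall u, range gC u -> u != 0 -> meval (u ord0) f = 0) <->
  (forall t, torus t -> meval ((monomial_map J alpha t *m invmx BC) ord0) f = 0).
Proof.
pose h z := meval ((M z *m invmx BC) ord0) f.
have Ph : polyfun h.
  apply: polyfun_meval => j; under eq_fun do rewrite mxE.
  apply: polyfun_sum => k; apply: polyfun_mul (polyfun_M k) _.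
  exact: polyfun_cst.
split=> [fg t tt|ft u [a _ <-] _].
- pose h' z := h z * \prod_(i < s) z`_i.
  have Ph' : polyfun h'.
    by apply: polyfun_mul => //; apply: polyfun_prod => i; exact: polyfun_coord.
  have h'0 := @polyfun_vanish _ s _ h' Ph' mono_dense.
  set z := [seq t ord0 l | l <- enum 'I_s].
  have sz : size z = s by rewrite size_map size_enum_ord.
  have /eqP : h' z = 0.
    apply: h'0 sz => P sP [a gP]; apply/eqP; rewrite mulf_eq0 orbC.
    rewrite -implyNb; apply/implyP => /prodf_neq0 Pn0; apply/eqP.
    rewrite /h -(gC_mono gP); apply: fg; first by exists a.
    have : M (map rc P) != 0 by apply: Mn0 => i i_s; exact: (Pn0 (Ordinal i_s)).
    apply: contraNneq => g0; move: (gC_mono gP); rewrite g0.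
    by move/(canLR (mulmxKV BC_unit)) => /= <-; rewrite mul0mx.
  rewrite mulf_eq0 => /orP[/eqP|/prodf_eq0[l _]].
    by rewrite monomial_mapE.
  by rewrite torus_nth (negPf (tt _)).
- have h0 := @polyfun_vanish _ s _ h Ph (thick_neq0 R s).
  have [P sP gP] := g_mono a.
  rewrite (gC_mono gP); apply: h0; last by rewrite size_map.
  move=> Q sQ Qn0.
  have -> : map rc Q = [seq (\row_(l < s) rc Q`_l) ord0 l | l <- enum 'I_s].
    apply: (@eq_from_nth _ 0) => [|i]; first by rewrite 2!size_map sQ size_enum_ord.
    rewrite size_map sQ => i_s; rewrite (nth_map 0) ?sQ//.
    rewrite (nth_map (Ordinal i_s)) ?size_enum_ord// mxE.
    by rewrite nth_enum_ord.
  rewrite /h -monomial_mapE; apply: ft => l.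
  by rewrite mxE fmorph_eq0; apply: Qn0.
Qed.

Lemma toric_of_monomials : toric (proj_closure (range gC)).
Proof.
exists s, J, alpha, (invmx BC); split.
- have [j jn] := mo_some; rewrite card_gt0; apply/set0Pn; exists j.
  by rewrite inE.
- by rewrite unitmx_inv.
apply/seteqP; split=> [v [v0 vcl]|_ [w [w0 wcl] <-]] /=.
- exists (v *m BC); last by rewrite /= mulmxK.
  split.
    by apply: contraNneq v0 => v0; rewrite -(mulmxK BC_unit v) v0 mul0mx.
  move=> e f hf fM; rewrite -meval_lin_subst.
  apply: (vcl e); first exact: homog_lin_subst.
  apply/vanish_iff => t tt; rewrite meval_lin_subst mulmxKV//.
  apply: fM; first by exists t.
  by rewrite monomial_mapE; apply: Mn0 => i i_s; rewrite torus_nth; exact: tt.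
- split.
    by apply: contraNneq w0 => w0; rewrite -(mulmxKV BC_unit w) w0 mul0mx.
  move=> e f hf fg; rewrite -meval_lin_subst; apply: (wcl e).
    exact: homog_lin_subst.
  move=> _ [t tt <-] _; rewrite meval_lin_subst.
  by move/vanish_iff: fg; apply.
Qed.
End ToricCriterion.

(** * Relations between signatures of paths and of subpaths *)

Section Words.
Variables (R : realType) (I : eqType).
Implicit Types (s : seq (I * R)) (w : seq I).

(** Steps of length 0 do not count, so a path realises the signatures of all
    paths whose shape is a subsequence of its own. *)
Lemma sig_pad s w : subseq (unzip1 s) w -> exists s', [/\ unzip1 s' = w,
  sig1 s' =1 sig1 s, sig2 s' =2 sig2 s &
  forall i j k, sig3 s' i j k = sig3 s i j k].
Proof.
elim: w s => [|y w IH] s; first by case: s => // _; exists [::].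
case: s => [|[x r] s] /=.
  move=> _; have [s' [<- s1 s2 s3]] := IH [::] (sub0seq _).
  exists ((y, 0) :: s'); split=> //= [i|i j|i j k].
  - by rewrite s1 /=; ring.
  - by rewrite s2 /=; ring.
  - by rewrite s3 /=; ring.
have [->|xy] := eqVneq x y => sw.
  have [s' [<- s1 s2 s3]] := IH s sw.
  exists ((y, r) :: s'); split=> //= [i|i j|i j k].
  - by rewrite s1.
  - by rewrite s1 s2.
  - by rewrite s1 s2 s3.
have [s' [<- s1 s2 s3]] := IH ((x, r) :: s) sw.
exists ((y, 0) :: s'); split=> //= [i|i j|i j k].
- by rewrite s1 /=; ring.
- by rewrite s2 /=; ring.
- by rewrite s3 /=; ring.
Qed.

Lemma sig2_shuffle s i j : sig2 s i j + sig2 s j i = sig1 s i * sig1 s j.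
Proof.
elim: s => [|[y r] s IH] /=; first by rewrite mul0r addr0.
by rewrite mulrDr !mulrDl -IH; field.
Qed.

Lemma sig1_notin s i : i \notin unzip1 s -> sig1 s i = 0.
Proof.
elim: s => [|[y r] s IH] //=; rewrite inE negb_or eq_sym => /andP[/negPf-> /IH->].
by rewrite mul0r addr0.
Qed.

Lemma sig2_eq0 s i j : i != j -> ~~ subseq [:: i; j] (unzip1 s) -> sig2 s i j = 0.
Proof.
move=> ij; elim: s => [|[y r] s IH] //=; rewrite eq_sym.
have [->|yi] := eqVneq y i; last by move=> /IH-> /=; ring.
rewrite sub1seq (negPf ij) => js; rewrite IH ?(sig1_notin js); last first.
  by apply: contraNN js => /mem_subseq; apply; rewrite !inE eqxx orbT.
by rewrite /=; ring.
Qed.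
End Words.

(** * Toric coordinates for the second signature *)
Section AxisVariety.
Variables (R : realType) (d m : nat) (nu : m.-tuple 'I_d).
Hypothesis m_gt0 : (0 < m)%N.

Lemma unzip1_steps (a : 'rV[R]_m) : unzip1 (steps nu a) = nu.
Proof. by rewrite /unzip1 -map_comp -[RHS](map_tnth_enum nu); exact: eq_map. Qed.

Lemma steps_surj (s : seq ('I_d * R)) :
  unzip1 s = nu -> exists a : 'rV[R]_m, steps nu a = s.
Proof.
move=> snu; exists (\row_p nth 0 (unzip2 s) p).
have ss : size s = m by rewrite -(size_map fst) -/(unzip1 s) snu size_tuple.
case: s snu ss => [|y0 s0]; first by move=> _ /= m0; exfalso; move: m_gt0; rewrite -m0.
set s := y0 :: s0 => snu ss.
apply: (@eq_from_nth _ y0); rewrite size_map size_enum_ord ?ss// => p pm.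
rewrite (nth_map (Ordinal pm)) ?size_enum_ord// mxE nth_enum_ord//.
rewrite (tnth_nth y0.1) nth_enum_ord// -snu !(nth_map y0) ?ss//.
by case: (nth _ _ _).
Qed.

Section LinearChange.
Variables (k n : nat) (terms : k.-tuple 'I_d -> seq (R * k.-tuple 'I_d)).
Variable mo : k.-tuple 'I_d -> option (seq nat).

(** The criterion in coordinates indexed by words, with the linear change given
    by the list of terms of each new coordinate. *)
Lemma toric_words :
    (forall u : k.-tuple 'I_d -> R,
       (forall v, \sum_(t <- terms v) t.1 * u t.2 = 0) -> forall v, u v = 0) ->
    (exists v, mo v != None) ->
    (forall v r, mo v = Some r -> all (fun i => (i < n)%N) r) ->
    let good a P := forall v,
      \sum_(t <- terms v) t.1 * signature (axis_path nu a) t.2 = mono P (mo v) in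
    (forall a, exists2 P, size P = n & good a P) ->
    thick n (fun P => exists a, good a P) ->
  toric (axis_variety R nu k).
Proof.
move=> inj [v0 mo_v0] mo_lt good ex dense.
pose B : 'M[R]_(tensor_dim d k) := \matrix_(p, q)
  \sum_(t <- terms (enum_val q)) (t.2 == enum_val p)%:R * t.1.
have BE (u : 'rV[R]_(tensor_dim d k)) q :
    (u *m B) ord0 q = \sum_(t <- terms (enum_val q)) t.1 * u ord0 (enum_rank t.2).
  rewrite mxE; under eq_bigr do rewrite mxE mulr_sumr.
  rewrite exchange_big /=; apply: eq_bigr => t _.
  rewrite (bigD1 (enum_rank t.2)) //= enum_rankK eqxx big1 ?addr0 => [|p pt].
    by rewrite mul1r mulrC.
  rewrite (_ : _ == _ = false) ?mul0r ?mulr0//; apply: contraNF pt => /eqP->.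
  by rewrite enum_valK.
have gB a q : (axis_signature k nu a *m B) ord0 q =
    \sum_(t <- terms (enum_val q)) t.1 * signature (axis_path nu a) t.2.
  by rewrite BE; apply: eq_bigr => t _; rewrite mxE enum_rankK.
apply: (@toric_of_monomials R _ n _ (axis_signature k nu) B (mo \o enum_val)).
- rewrite -row_free_unit; apply: inj_row_free => u uB0; apply/rowP => q.
  rewrite mxE -[q]enum_valK; move: (enum_val q).
  apply: (inj (fun v => u ord0 (enum_rank v))) => v.
  by have /rowP/(_ (enum_rank v)) := uB0; rewrite BE mxE enum_rankK.
- by exists (enum_rank v0); rewrite /= enum_rankK.
- by move=> q r; exact: mo_lt.
- by move=> a; have [P sP gP] := ex a; exists P => // q; rewrite gB gP.
- by apply: thick_sub dense => P _ [a gP]; exists a => q; rewrite gB gP.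
Qed.
End LinearChange.

Section Order2.
Variables (ls : seq 'I_d) (n : nat) (inv : 'I_d -> 'I_d -> option (seq nat)).
Hypothesis ls_all : forall i, i \in ls.
Hypothesis n_ge : (size ls <= n)%N.
Hypothesis inv_lt : forall i j r, inv i j = Some r -> all (fun l => (l < n)%N) r.

(** The parameters [P] describe the second signature of the path [s]: their
    first entries are the total displacements, and each entry of the signature
    below the diagonal, for the order of the letters in [ls], is a monomial or
    0. *)
Definition fits2 (s : seq ('I_d * R)) (P : seq R) :=
  (forall i, sig1 s i = P`_(index i ls)) /\
  (forall i j, (index j ls < index i ls)%N -> sig2 s i j = mono P (inv i j)).

(** By the shuffle relation the entries [ij] and [ji] add up to the product of
    two displacements. Replacing the upper entries by these sums leaves only the
    lower ones to be described. *)
Lemma toric_order2 :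
    (forall s, unzip1 s = nu -> exists2 P, size P = n & fits2 s P) ->
    thick n (fun P => exists2 s, subseq (unzip1 s) nu & fits2 s P) ->
  toric (axis_variety R nu 2).
Proof.
move=> ex dense.
pose pr (i j : 'I_d) : 2.-tuple 'I_d := [tuple i; j].
pose fst2 (v : 2.-tuple 'I_d) := tnth v ord0.
pose snd2 (v : 2.-tuple 'I_d) := tnth v (lift ord0 ord0).
have prE v : v = pr (fst2 v) (snd2 v).
  by apply: val_inj; case: v => [[|i [|j []]]] //= ?; rewrite /fst2 /snd2 !(tnth_nth i).
pose terms v := let i := fst2 v in let j := snd2 v in
  if (index i ls <= index j ls)%N then [:: (1 : R, pr i j); (1, pr j i)]
  else [:: (1, pr i j)].
pose mo v := let i := fst2 v in let j := snd2 v in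
  if (index i ls <= index j ls)%N then Some [:: index i ls; index j ls]
  else inv i j.
have ix i : (index i ls < n)%N by rewrite (leq_trans _ n_ge)// index_mem.
have sumE (u : 2.-tuple 'I_d -> R) v : \sum_(t <- terms v) t.1 * u t.2 =
    if (index (fst2 v) ls <= index (snd2 v) ls)%N
    then u (pr (fst2 v) (snd2 v)) + u (pr (snd2 v) (fst2 v))
    else u (pr (fst2 v) (snd2 v)).
  by rewrite /terms; case: ifP => _; rewrite !big_cons big_nil /= !mul1r addr0.
have good a P : fits2 (steps nu a) P -> forall v,
    \sum_(t <- terms v) t.1 * signature (axis_path nu a) t.2 = mono P (mo v).
  move=> [f1 f2] v; rewrite sumE /mo.
  move: (fst2 v) (snd2 v) => i j; rewrite (signature2 nu a m_gt0 i j).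
  case: leqP => ij; last exact: f2.
  rewrite (signature2 nu a m_gt0 j i) sig2_shuffle !f1 /mono.
  by rewrite big_cons big_cons big_nil mulr1.
have y0 : 'I_d by exact: (tnth nu (Ordinal m_gt0)).
apply: (@toric_words 2 n terms mo).
- move=> u u0.
  have low i j : (index j ls < index i ls)%N -> u (pr i j) = 0.
    move=> ij; have := u0 (pr i j).
    by rewrite sumE /fst2 /snd2 !(tnth_nth y0) /= leqNgt ij.
  move=> v; rewrite [v]prE; set i := fst2 v; set j := snd2 v.
  have := u0 v; rewrite sumE -/i -/j; case: (ltngtP (index i ls) (index j ls)) => ij.
  + by rewrite (low j i)// addr0.
  + by move=> _; exact: low.
  + have -> : i = j by rewrite -(nth_index y0 (ls_all i)) ij nth_index.
    by move=> /eqP; rewrite -mulr2n mulrn_eq0 => /eqP.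
- by exists (pr y0 y0); rewrite /mo /fst2 /snd2 !(tnth_nth y0) leqnn.
- move=> v r; rewrite /mo; case: leqP => _; last exact: inv_lt.
  by move=> [<-]; rewrite /= !ix.
- move=> a; have [P sP /good gP] := ex _ (unzip1_steps a).
  by exists P.
- apply: thick_sub dense => P _ [s /sig_pad[s' [/steps_surj[a <-] s1 s2 _]] [f1 f2]].
  by exists a; apply: good; split=> [i|i j]; rewrite ?s1 ?s2; [exact: f1|exact: f2].
Qed.
End Order2.
End AxisVariety.

(** * Toric coordinates for the third signature in two letters *)

Lemma sig3_shuffle (R : realType) (I : eqType) (s : seq (I * R)) i j k :
  sig2 s i j * sig1 s k = sig3 s k i j + sig3 s i k j + sig3 s i j k.
Proof.
elim: s => [|[y r] s IH] /=; first by ring.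
rewrite mulrDr [in LHS]mulrDl [in LHS]mulrDl IH.
rewrite -[_ * r * sig1 s j * sig1 s k]mulrA -(sig2_shuffle s j k).
by field.
Qed.

(** Since the logarithm of a signature is a Lie series, the third signature in
    two letters is linear in the cubic monomials of the displacements [x] and
    [y], in [p x] and [p y] for [p] the [ba] entry at level 2, and in two more
    coordinates, for which twice the entries [baa] and [bba] are taken. In these
    eight coordinates it is a vector of monomials as soon as [p] and the last
    two are monomials or 0. *)
Section Binary3.
Variables (R : realType) (d m : nat) (nu : m.-tuple 'I_d).
Hypothesis m_gt0 : (0 < m)%N.
Variables (a b : 'I_d) (n : nat) (mp mr ms : option (seq nat)).
Hypothesis ab : a != b.
Hypothesis ab_all : forall i, (i == a) || (i == b).
Hypothesis n_ge2 : (1 < n)%N.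
Hypothesis mp_lt : all (fun l => (l < n)%N) (odflt [::] mp).
Hypothesis mr_lt : all (fun l => (l < n)%N) (odflt [::] mr).
Hypothesis ms_lt : all (fun l => (l < n)%N) (odflt [::] ms).

Definition fits3 (s : seq ('I_d * R)) (P : seq R) :=
  [/\ sig1 s a = P`_0, sig1 s b = P`_1, sig2 s b a = mono P mp,
      2 * sig3 s b a a = mono P mr & 2 * sig3 s b b a = mono P ms].

(* Words are coded by triples of booleans, [true] for [a]. *)
Let l (x : bool) := if x then a else b.
Let wd (x y z : bool) : 3.-tuple 'I_d := [tuple l x; l y; l z].

Let tm (x y z : bool) : seq (R * 3.-tuple 'I_d) :=
  match x, y, z with
  | true, true, true => [:: (6, wd true true true)]
  | false, false, false => [:: (6, wd false false false)]
  | true, true, false => [:: (2, wd true true false); (2, wd true false true);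
                             (2, wd false true true)]
  | true, false, true => [:: (1, wd true false true); (2, wd false true true)]
  | false, true, true => [:: (2, wd false true true)]
  | true, false, false => [:: (2, wd true false false); (2, wd false true false);
                              (2, wd false false true)]
  | false, true, false => [:: (1, wd false true false); (2, wd false false true)]
  | false, false, true => [:: (2, wd false false true)]
  end.

Let mo3 (x y z : bool) : option (seq nat) :=
  match x, y, z with
  | true, true, true => Some [:: 0; 0; 0]
  | false, false, false => Some [:: 1; 1; 1]
  | true, true, false => Some [:: 0; 0; 1]
  | true, false, false => Some [:: 0; 1; 1]
  | true, false, true => omap (cons 0) mp
  | false, true, false => omap (cons 1) mp
  | false, true, true => mr
  | false, false, true => ms
  end%N.

Lemma toric_binary3 :
    (forall s, unzip1 s = nu -> exists2 P, size P = n & fits3 s P) ->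
    thick n (fun P => exists2 s, subseq (unzip1 s) nu & fits3 s P) ->
  toric (axis_variety R nu 3).
Proof.
move=> ex dense.
pose t0 (v : 3.-tuple 'I_d) := tnth v ord0 == a.
pose t1 (v : 3.-tuple 'I_d) := tnth v (lift ord0 ord0) == a.
pose t2 (v : 3.-tuple 'I_d) := tnth v (lift ord0 (lift ord0 ord0)) == a.
have lK i : l (i == a) = i.
  by rewrite /l; have := ab_all i; case: eqP => [->|_ /= /eqP ->].
have lE x : (l x == a) = x by case: x; rewrite /l ?eqxx// eq_sym (negPf ab).
have wdK v : wd (t0 v) (t1 v) (t2 v) = v.
  apply: val_inj; case: v => [[|i [|j [|k []]]]] //= ?.
  by rewrite /t0 /t1 /t2 !(tnth_nth i) /= !lK.
have [tw0 tw1 tw2] : [/\ forall x y z, t0 (wd x y z) = x,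
    forall x y z, t1 (wd x y z) = y & forall x y z, t2 (wd x y z) = z].
  by split=> x y z; rewrite /t0 /t1 /t2 (tnth_nth a) /= lE.
have good c P : fits3 (steps nu c) P -> forall v,
    \sum_(t <- tm (t0 v) (t1 v) (t2 v)) t.1 * signature (axis_path nu c) t.2
    = mono P (mo3 (t0 v) (t1 v) (t2 v)).
  have sE x y z : signature (axis_path nu c) (wd x y z) =
      sig3 (steps nu c) (l x) (l y) (l z) by exact: signature3.
  move: (steps nu c) sE => s sE [fa fb fp fr fs] v.
  have consE i o : mono P (omap (cons i) o) = P`_i * mono P o.
    by case: o => [r|] /=; rewrite ?big_cons ?mulr0.
  have saa := sig2_shuffle s a a; have sbb := sig2_shuffle s b b.
  have saaa := sig3_shuffle s a a a; have sbbb := sig3_shuffle s b b b.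
  have saab := sig3_shuffle s a a b; have sbba := sig3_shuffle s b b a.
  have sbaa := sig3_shuffle s b a a; have sbab := sig3_shuffle s b a b.
  case: (t0 v); case: (t1 v); case: (t2 v);
    rewrite /tm !big_cons big_nil [fst _]/= [snd _]/= ?sE /l /mo3 ?consE;
    rewrite -?fp -?fr -?fs -?fa -?fb /=
      ?big_cons ?big_nil -?fa -?fb.
  - by rewrite mulr1 [RHS]mulrA -saa [RHS]mulrDl saaa; ring.
  - by rewrite mulr1 [RHS]mulrA -saa [RHS]mulrDl saab; ring.
  - by rewrite [RHS]mulrC sbaa; ring.
  - by rewrite mulr1 -sbb [RHS]mulrC [RHS]mulrDl sbba; ring.
  - by rewrite addr0.
  - by rewrite [RHS]mulrC sbab; ring.
  - by rewrite addr0.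
  - by rewrite mulr1 [RHS]mulrA -sbb [RHS]mulrDl sbbb; ring.
pose terms v := tm (t0 v) (t1 v) (t2 v).
pose mo v := mo3 (t0 v) (t1 v) (t2 v).
apply: (@toric_words R d m nu 3 n terms mo); rewrite /terms /mo.
- move=> u u0 v; rewrite -[v]wdK.
  have {}u0 x y z : \sum_(t <- tm x y z) t.1 * u t.2 = 0.
    by have := u0 (wd x y z); rewrite tw0 tw1 tw2.
  have := u0 true true true; have := u0 true true false.
  have := u0 true false true; have := u0 true false false.
  have := u0 false true true; have := u0 false true false.
  have := u0 false false true; have := u0 false false false.
  rewrite /tm !big_cons !big_nil /= => e0 e1 e2 e3 e4 e5 e6 e7.
  by case: (t0 v); case: (t1 v); case: (t2 v); lra.
- by exists (wd true true true); rewrite tw0 tw1 tw2.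
- have n_gt0 : (0 < n)%N by exact: ltnW.
  move=> v r; case: (t0 v); case: (t1 v); case: (t2 v) => /=;
    first [by move=> [<-] /=; rewrite ?n_gt0 ?n_ge2
          |by move: mp_lt; case: mp => //= r' r'n [<-] /=; rewrite ?n_gt0 ?n_ge2
          |by move=> E; move: mr_lt; rewrite E
          |by move=> E; move: ms_lt; rewrite E].
- move=> c; have [P sP /good gP] := ex _ (unzip1_steps nu c).
  by exists P.
- apply: thick_sub dense => P _ [s /sig_pad[s' [/(steps_surj m_gt0)[c <-] s1 s2 s3]]].
  move=> [fa fb fp fr fs]; exists c; apply: good.
  by split; rewrite ?s1 ?s2 ?s3.
Qed.
End Binary3.

(** * Classification of shapes by subsequences *)

(** A list of shapes covers all words if a finite automaton says so. Its states
    are lists of residual shapes: reading a letter removes it from the front of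
    every pattern that starts with it, and a shape one of whose forbidden
    patterns has become empty is discarded. The first components list patterns
    at least one of which must occur as a subsequence, the second ones forbidden
    subsequences. *)
Section Shapes.
Variables (T : eqType) (letters : seq T).

Definition shape := (seq (seq T) * seq (seq T))%type.
Implicit Types (sh : shape) (st : seq shape) (w p : seq T).

Definition has_shape w sh := has (subseq^~ w) sh.1 && ~~ has (subseq^~ w) sh.2.

Definition strip y p := if p is x :: p' then if x == y then p' else p else [::].

Definition residual y sh : shape := (map (strip y) sh.1, map (strip y) sh.2).

Definition residuals y st :=
  [seq sh <- map (residual y) st | [::] \notin sh.2].

(** Whatever follows, a sealed shape has been found; the automaton need not be
    explored beyond such a state. *)
Definition sealed sh := ([::] \in sh.1) && nilp sh.2.

Fixpoint explore (fuel : nat) (seen todo : seq (seq shape)) :=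
  if fuel is fuel'.+1 then
    let next := [seq st <- undup [seq residuals y st | st <- todo, y <- letters] |
                 ~~ has sealed st & st \notin seen] in
    explore fuel' (next ++ seen) next
  else seen.

Definition closed_states (states : seq (seq shape)) :=
  all (fun st => has (has_shape [::]) st &&
         all (fun y => let st' := residuals y st in
                       has sealed st' || (st' \in states)) letters) states.

Lemma has_shape_cons y w sh : has_shape (y :: w) sh = has_shape w (residual y sh).
Proof.
rewrite /has_shape /= !has_map.
by congr (_ && ~~ _); apply: eq_has => -[|x p] /=; rewrite ?sub0seq//; case: eqP.
Qed.

Lemma has_residuals y w st :
  has (has_shape w) (residuals y st) -> has (has_shape (y :: w)) st.
Proof.
case/hasP => _ /[!mem_filter]/andP[_ /mapP[sh shin ->]] shw.
by apply/hasP; exists sh => //; rewrite has_shape_cons.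
Qed.

Lemma shape_cover states st w : closed_states states -> st \in states ->
  {subset w <= letters} -> has (has_shape w) st.
Proof.
move=> /allP cl; elim: w st => [|y w IH] st /cl/andP[// st0 /allP sty] wl.
apply: has_residuals.
have /orP[/hasP[sh shin /andP[sh1 /nilP sh2]]|stin] := sty y (wl y (mem_head _ _)).
  apply/hasP; exists sh => //; rewrite /has_shape sh2 andbT.
  by apply/hasP; exists [::] => //; exact: sub0seq.
by apply: IH => // x xw; rewrite wl// inE xw orbT.
Qed.
End Shapes.

(** The shortest shapes for which the displacements and the three lower entries
    of the second signature are algebraically independent, up to renaming the
    letters. *)
Definition free3 (I : Type) (a b c : I) : seq (seq I) :=
  [:: [:: a; b; a; c; a; b]; [:: a; b; a; c; b; a]; [:: a; b; c; a; b; a];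
      [:: a; b; c; a; b; c]; [:: a; b; c; a; c; b]; [:: a; b; c; b; a; b];
      [:: a; b; c; b; a; c]].

(** Each line is a way in which monomials describe the lower entries [ba],
    [ca], [cb] of the second signature, for [a < b < c]: all 0; only [cb] free;
    only [ba] free; only [cb] zero; [a] only at the two ends of the word, with
    [cb] zero or free; [b] only in the middle, between two parts without [c]
    before [a], which makes the three entries the pairwise products of three
    lengths; all free. *)
Definition shapes3 (I : Type) (a b c : I) : seq (seq (seq I) * seq (seq I)) :=
  [:: ([:: [:: a; b; c]], [:: [:: b; a]; [:: c; a]; [:: c; b]]);
      ([:: [:: a; b; c; b]], [:: [:: b; a]; [:: c; a]]);
      ([:: [:: a; b; a; c]], [:: [:: c; a]; [:: c; b]]);
      ([:: [:: b; a; b; c; a]; [:: a; b; a; c; a]; [:: a; b; c; a; c]],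
       [:: [:: c; b]]);
      ([:: [:: a; b; c; a]],
       [:: [:: c; b]; [:: b; a; b]; [:: b; a; c]; [:: c; a; b]; [:: c; a; c]]);
      ([:: [:: a; b; c; b; a]],
       [:: [:: b; a; b]; [:: b; a; c]; [:: c; a; b]; [:: c; a; c]]);
      ([:: [:: a; c; b; a; c]],
       [:: [:: c; a; b]; [:: b; c; a]; [:: b; a; b]; [:: b; c; b]]);
      (free3 a b c, [::])].

(** Words in two letters with two, three and four blocks, and longer ones. From
    five blocks on, the displacements, the entry [ba] at level 2 and the entries
    [baa], [bba] at level 3 are algebraically independent. *)
Definition shapes2 (I : Type) (a b : I) : seq (seq (seq I) * seq (seq I)) :=
  [:: ([:: [:: a; b]], [:: [:: b; a]]);
      ([:: [:: a; b; a]], [:: [:: b; a; b]]);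
      ([:: [:: a; b; a; b]], [:: [:: b; a; b; a]]);
      ([:: [:: a; b; a; b; a]], [::])].

(** Words in which a letter does not occur are set aside, by adding shapes that
    accept them. *)
Definition missing (I : Type) (letters : seq I) : seq (seq (seq I) * seq (seq I)) :=
  [seq ([:: [::]], [:: [:: y]]) | y <- letters].

Lemma classify (T : eqType) (letters w : seq T) (shapes : seq (shape T)) fuel :
    closed_states letters (explore letters fuel [:: missing letters ++ shapes]
                                                [:: missing letters ++ shapes]) ->
  w =i letters -> has (has_shape w) shapes.
Proof.
move=> cl wl; set st0 := missing letters ++ shapes in cl.
have : st0 \in explore letters fuel [:: st0] [:: st0].
  have H n : forall seen todo, st0 \in seen -> st0 \in explore letters n seen todo.
    by elim: n => [|n IH] seen todo //= s0; apply: IH; rewrite mem_cat s0 orbT.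
  by apply: H; rewrite mem_head.
move=> /(shape_cover cl)-/(_ w (fun x => etrans (esym (wl x)))).
rewrite has_cat => /orP[|//].
move=> /hasP[_ /mapP[y yl ->]]; rewrite /has_shape /= sub0seq sub1seq wl yl.
by [].
Qed.

Lemma has_shape_map (T T' : eqType) (f : T -> T') (w : seq T) (sh : shape T) :
    injective f ->
  has_shape (map f w) (map (map f) sh.1, map (map f) sh.2) = has_shape w sh.
Proof.
move=> f_inj; have sub p : subseq (map f p) (map f w) = subseq p w.
  elim: w p => [|y w IH] [|x p] //=.
  by rewrite (inj_eq f_inj); case: eqP => _; [exact: IH|exact: (IH (x :: p))].
by rewrite /has_shape /= !has_map; congr (_ && ~~ _); apply: eq_has => p /=.
Qed.

Definition orderings3 (I : Type) (x y z : I) : seq (I * I * I) :=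
  [:: (x, y, z); (x, z, y); (y, x, z); (y, z, x); (z, x, y); (z, y, x)].

(** Verified by running the automaton: up to sealed states, it has about a
    hundred states. Letters are coded by numbers to make this fast. *)
Lemma classify3 (w : seq 'I_3) : (forall i, i \in w) ->
  exists a b c : 'I_3, [/\ uniq [:: a; b; c], (forall i, i \in [:: a; b; c]) &
    has (has_shape w) (shapes3 a b c)].
Proof.
move=> wi.
pose x0 : 'I_3 := @Ordinal 3 0 isT.
pose x1 : 'I_3 := @Ordinal 3 1 isT.
pose x2 : 'I_3 := @Ordinal 3 2 isT.
pose os := orderings3 x0 x1 x2.
have wl : map val w =i [:: 0; 1; 2]%N.
  move=> i; apply/mapP/idP => [[j _ ->]|]; first by case: j => [[|[|[]]]].
  by rewrite !inE => /or3P[]/eqP->; [exists x0|exists x1|exists x2].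
have := @classify _ [:: 0; 1; 2]%N (map val w)
  (flatten [seq shapes3 (val o.1.1) (val o.1.2) (val o.2) | o <- os]) 9
  ltac:(by vm_compute) wl.
case/hasP => sh /flattenP[_ /mapP[[[a b] c] oin ->] shin] shw.
exists a, b, c; split.
- move: oin; rewrite !inE; do 5 (case/orP => [/eqP[-> -> ->] // | ]).
  by move=> /eqP[-> -> ->].
- move: oin; rewrite !inE; do 5 (case/orP => [/eqP[-> -> ->] /= [[|[|[|]]]] // | ]).
  by move=> /eqP[-> -> ->] /= [[|[|[|]]]].
- have : has (has_shape (map val w)) (shapes3 (val a) (val b) (val c)).
    by apply/hasP; exists sh.
  rewrite -[shapes3 (val a) _ _]/(map (fun sh : shape 'I_3 =>
    (map (map val) sh.1, map (map val) sh.2)) (shapes3 a b c)) has_map.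
  by apply: sub_has => sh' /=; rewrite has_shape_map//; exact: val_inj.
Qed.

Lemma classify2 (w : seq 'I_2) : (forall i, i \in w) ->
  exists a b : 'I_2, [/\ a != b, (forall i, (i == a) || (i == b)) &
    has (has_shape w) (shapes2 a b)].
Proof.
move=> wi.
pose x0 : 'I_2 := @Ordinal 2 0 isT.
pose x1 : 'I_2 := @Ordinal 2 1 isT.
have wl : w =i [:: x0; x1] by move=> i; rewrite wi; case: i => [[|[|]]].
have := @classify _ [:: x0; x1] w (shapes2 x0 x1 ++ shapes2 x1 x0) 9
  ltac:(by vm_compute) wl.
rewrite has_cat => /orP[shw|shw]; [exists x0, x1|exists x1, x0]; split=> //;
  by case=> [[|[|]]].
Qed.

(** * Polynomial relations forced by forbidden subsequences *)

Section Relations.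
Variables (R : realType) (I : eqType).
Implicit Types (s t : seq (I * R)) (w : seq I) (a b c e i j k y : I).

Lemma unzip1_catP s w1 w2 : unzip1 s = w1 ++ w2 ->
  exists s1 s2, [/\ s = s1 ++ s2, unzip1 s1 = w1 & unzip1 s2 = w2].
Proof.
move=> sw; exists (take (size w1) s), (drop (size w1) s).
by rewrite cat_take_drop /unzip1 map_take map_drop -/(unzip1 s) sw take_size_cat
  ?drop_size_cat.
Qed.

Lemma first_occurrence b w : b \in w -> exists w1 w2, w = w1 ++ b :: w2 /\ b \notin w1.
Proof.
elim: w => // y w IH; rewrite inE; have [-> _|yb /= bw] := eqVneq b y.
  by exists [::], w.
have [w1 [w2 [-> bw1]]] := IH bw.
by exists (y :: w1), w2; rewrite inE negb_or yb.
Qed.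

Lemma sig2_notinl s i j : i \notin unzip1 s -> sig2 s i j = 0.
Proof.
elim: s => [|[y r] s IH] //=; rewrite inE negb_or eq_sym => /andP[/negPf-> /IH->].
by rewrite /=; ring.
Qed.

Lemma sig2_notinr s i j : j \notin unzip1 s -> sig2 s i j = 0.
Proof.
elim: s => [|[y r] s IH] //=; rewrite inE negb_or eq_sym => /andP[/negPf-> js].
by rewrite IH// (sig1_notin js) /=; ring.
Qed.

(** Both lemmas: an entry of the signature is 0 if two adjacent letters of its
    word never occur in this order. *)
Lemma sig3_eq0l s i j k : i != j -> ~~ subseq [:: i; j] (unzip1 s) ->
  sig3 s i j k = 0.
Proof.
move=> ij; elim: s => [|[y r] s IH] //=; rewrite eq_sym.
have [->|yi] := eqVneq y i; last by move=> /IH-> /=; ring.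
rewrite sub1seq (negPf ij) => js; rewrite (sig2_notinl _ js) IH /=; last first.
  by apply: contraNN js => /mem_subseq; apply; rewrite !inE eqxx orbT.
by ring.
Qed.

Lemma sig3_eq0r s i j k : i != j -> ~~ subseq [:: i; j] (unzip1 s) ->
  sig3 s k i j = 0.
Proof.
move=> ij; elim: s => [|[y r] s IH] ns //.
have ns' : ~~ subseq [:: i; j] (unzip1 s).
  by apply: contraNN ns => /subseq_trans; apply; exact: subseq_cons.
rewrite /= (IH ns') (sig2_eq0 ij ns'); move: ns; rewrite /= eq_sym.
have [->|yi] := eqVneq y i; last by rewrite /= => _; ring.
by rewrite sub1seq => /sig1_notin->; rewrite (negPf ij) /=; ring.
Qed.

(** If [a] never occurs between two other letters, all its occurrences are
    before or after all the other letters, and [u] is the total length of those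
    that come after. *)
Lemma outer_letter s a :
    (forall y e, y != a -> e != a -> ~~ subseq [:: y; a; e] (unzip1 s)) ->
  exists u, forall e, e != a -> sig2 s e a = sig1 s e * u.
Proof.
elim: s => [|[y r] s IH] ns; first by exists 0 => e _ /=; rewrite mulr0.
have [ya|ya] := eqVneq y a.
  have [|u uE] := IH.
    move=> x e xa ea; apply: contraNN (ns x e xa ea) => /subseq_trans; apply.
    exact: subseq_cons.
  exists u => e ea; rewrite /= (uE e ea) ya [a == e]eq_sym (negPf ea) /=; ring.
exists (sig1 s a) => e ea.
have sae : sig2 s a e = 0.
  apply: sig2_eq0; first by rewrite eq_sym.
  by apply: contraNN (ns y e ya ea); rewrite /= eqxx.
have := sig2_shuffle s e a; rewrite sae addr0 /= => ->.
by rewrite (negPf ya) /=; ring.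
Qed.

(** Cut the word before its first [b]. The forbidden subsequences put every
    [b] before every [a] and [c] of the second part, and on neither side does a
    [c] come before an [a]. So [u] and [v] are the lengths of [c] before the cut
    and of [a] after it. *)
Lemma pivot_letter s a b c : uniq [:: a; b; c] -> b \in unzip1 s ->
    all (fun p => ~~ subseq p (unzip1 s))
        [:: [:: c; a; b]; [:: b; c; a]; [:: b; a; b]; [:: b; c; b]] ->
  exists u v, [/\ sig2 s b a = sig1 s b * v, sig2 s c a = u * v &
                  sig2 s c b = u * sig1 s b].
Proof.
rewrite /= !inE negb_or !andbT => /andP[/andP[ab ac] bc].
move=> /first_occurrence[w1 [w2 [sw bw1]]]; rewrite sw => /and4P[cab bca bab bcb].
have [s1 [t [st sw1 tw2]]] := unzip1_catP sw.
have no w p : subseq p w -> ~~ subseq (b :: p) (w1 ++ b :: w) -> False.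
  move=> pw /negP; apply; apply: (@cat_subseq _ [::] (b :: p)).
    exact: sub0seq.
  by rewrite /= eqxx.
have Ht i j : b != i -> subseq [:: i; j] (b :: w2) = subseq [:: i; j] w2.
  by move=> bi; rewrite /= eq_sym (negPf bi).
have ba : b != a by rewrite eq_sym.
have ca : c != a by rewrite eq_sym.
have cb : c != b by rewrite eq_sym.
have c_a1 : sig2 s1 c a = 0.
  apply: sig2_eq0 => //; rewrite sw1; apply: contraNN cab => c1.
  by apply: (@cat_subseq _ [:: c; a] [:: b]); rewrite //= eqxx sub0seq.
have c_a2 : sig2 t c a = 0.
  apply: sig2_eq0 => //; rewrite tw2 Ht//; apply/negP => /no; exact.
have a_b2 : sig2 t a b = 0.
  apply: sig2_eq0 => //; rewrite tw2 Ht//; apply/negP => /no; exact.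
have c_b2 : sig2 t c b = 0.
  apply: sig2_eq0 => //; rewrite tw2 Ht//; apply/negP => /no; exact.
have b1 : sig1 s1 b = 0 by apply: sig1_notin; rewrite sw1.
have ba1 : sig2 s1 b a = 0 by apply: sig2_notinl; rewrite sw1.
have cb1 : sig2 s1 c b = 0 by apply: sig2_notinr; rewrite sw1.
have ba2 : sig2 t b a = sig1 t b * sig1 t a.
  by rewrite -sig2_shuffle a_b2 addr0.
exists (sig1 s1 c), (sig1 t a); rewrite st !sig2_cat !sig1_cat.
by rewrite c_a1 c_a2 c_b2 b1 ba1 cb1 ba2; split; ring.
Qed.

(** Cut the word before the first [a] that follows a [b]: neither part has
    a [b] before an [a], so [u] and [v] are the lengths of [b] before the cut
    and of [a] after it. *)
Lemma alternating4 s a b : a != b -> ~~ subseq [:: b; a; b; a] (unzip1 s) ->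
  exists u v : R, [/\ sig2 s b a = u * v, 2 * sig3 s b a a = u * v * v,
    2 * sig3 s b b a = u * u * v &
    ~~ subseq [:: b; a; b] (unzip1 s) -> u = sig1 s b].
Proof.
move=> ab baba; have ba : b != a by rewrite eq_sym.
suff [s1 [t [st s1ba tba tb]]] : exists s1 t, [/\ s = s1 ++ t,
    ~~ subseq [:: b; a] (unzip1 s1), ~~ subseq [:: b; a] (unzip1 t) &
    ~~ subseq [:: b; a; b] (unzip1 s) -> b \notin unzip1 t].
  exists (sig1 s1 b), (sig1 t a); rewrite st !sig2_cat !sig3_cat !sig1_cat.
  rewrite !(sig2_eq0 ba)// !(sig3_eq0l _ ba)// !(sig3_eq0r _ ba)//.
  have aa := sig2_shuffle t a a; have bb := sig2_shuffle s1 b b.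
  split; first by ring.
  - by rewrite -mulrA -aa; ring.
  - by rewrite -bb; ring.
  - by rewrite -st => /tb/sig1_notin->; rewrite addr0.
have [sba|sba] := boolP (subseq [:: b; a] (unzip1 s)); last first.
  by exists s, [::]; rewrite cats0.
have bs : b \in unzip1 s by apply: (mem_subseq sba); rewrite mem_head.
have [w1 [w2 [sw bw1]]] := first_occurrence bs.
have skip w p : subseq (b :: p) (w1 ++ b :: w) = subseq p w.
  elim: w1 bw1 {sw} => [|y w' IH] /=; first by rewrite eqxx.
  by rewrite inE negb_or => /andP[/negPf-> /IH].
have /first_occurrence[w3 [w4 [w2E aw3]]] : a \in w2.
  by rewrite -sub1seq -(skip w2) -sw.
move: sw; rewrite w2E -cat_cons catA => sw.
have [s1 [t [st s1E tE]]] := unzip1_catP sw.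
have skip2 p : subseq p w4 -> subseq [:: b, a & p] (unzip1 s).
  move=> pw; rewrite sw -catA cat_cons skip.
  by apply: (@cat_subseq _ [::] (a :: p)); rewrite ?sub0seq //= eqxx.
exists s1, t; rewrite s1E tE; split=> //.
- by rewrite skip sub1seq.
- by rewrite /= (negPf ba); apply: contraNN baba => /skip2.
- by rewrite inE negb_or ba /=; apply: contraNN => bw4; apply: skip2; rewrite sub1seq.
Qed.

End Relations.

(** * Density of the parameters for two and three letters *)

Section Densities.
Variable R : realType.
Implicit Types S : seq R -> Prop.

Lemma thick3_nonzero S : (forall x y z, x != 0 -> y != 0 -> z != 0 -> S [:: x; y; z]) ->
  thick 3 S.
Proof.
move=> H; do 3 (apply: (@thick_cofinite _ _ _ [:: 0]) => ?; rewrite inE => ?).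
exact: H.
Qed.

Lemma thick4_nonzero S :
    (forall x y z p, x != 0 -> y != 0 -> z != 0 -> p != 0 -> S [:: x; y; z; p]) ->
  thick 4 S.
Proof.
move=> H; do 4 (apply: (@thick_cofinite _ _ _ [:: 0]) => ?; rewrite inE => ?).
exact: H.
Qed.

(** The excluded values below are those at which the denominators of the step
    lengths chosen later vanish. *)
Lemma thick5_generic S :
    (forall x y z p q, x != 0 -> y != 0 -> z != 0 -> p != 0 -> q != 0 ->
       x * z - q != 0 -> S [:: x; y; z; p; q]) ->
  thick 5 S.
Proof.
move=> H; apply: (@thick_cofinite _ _ _ [:: 0]) => x; rewrite inE => x0.
apply: (@thick_cofinite _ _ _ [:: 0]) => y; rewrite inE => y0.
apply: (@thick_cofinite _ _ _ [:: 0]) => z; rewrite inE => z0.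
apply: (@thick_cofinite _ _ _ [:: 0]) => p; rewrite inE => p0.
apply: (@thick_cofinite _ _ _ [:: 0; x * z]) => q.
rewrite !inE negb_or => /andP[q0 qxz]; apply: H => //.
by rewrite subr_eq0 eq_sym.
Qed.

Lemma thick6_last S :
    (forall x y z p q, x != 0 -> y != 0 -> z != 0 -> p != 0 -> q != 0 ->
       thick 1 (fun P => S [:: x, y, z, p, q & P])) ->
  thick 6 S.
Proof.
move=> H; do 5 (apply: (@thick_cofinite _ _ _ [:: 0]) => ?; rewrite inE => ?).
exact: H.
Qed.

Lemma thick6_generic S :
    (forall x y z p q r, x != 0 -> y != 0 -> z != 0 -> p != 0 -> q != 0 ->
       r != 0 -> y * z - r != 0 -> S [:: x; y; z; p; q; r]) ->
  thick 6 S.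
Proof.
move=> H; apply: thick6_last => x y z p q x0 y0 z0 p0 q0.
apply: (@thick_cofinite _ _ _ [:: 0; y * z]) => r.
rewrite !inE negb_or => /andP[r0 ryz]; apply: H => //.
by rewrite subr_eq0 eq_sym.
Qed.

Lemma poly_nonroot (Q : {poly R}) : Q != 0 -> exists z, Q.[z] != 0.
Proof.
move=> Q0; pose l := [seq (k%:R : R) | k <- iota 0 (size Q)].
have [/(max_poly_roots Q0)|] := boolP (all (root Q) l).
  rewrite map_inj_uniq ?iota_uniq; last exact: mulrIn (oner_neq0 R).
  by rewrite size_map size_iota ltnn => /(_ isT).
by rewrite -has_predC => /hasP[z _ zQ]; exists z.
Qed.

(** A rational function that is not constant takes infinitely many values,
    since each value is taken at the zeros of a nonzero polynomial only. *)
Lemma thick_rational (N D : {poly R}) S : D != 0 ->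
    (forall v, N - v *: D != 0) ->
    (forall z, z != 0 -> D.[z] != 0 -> S [:: N.[z] / D.[z]]) ->
  thick 1 S.
Proof.
move=> D0 ND0 H bad.
have [|z] := @poly_nonroot ('X * D * \prod_(v <- bad) (N - v *: D)).
  rewrite !mulf_neq0 ?polyX_eq0// prodf_seq_neq0.
  by apply/allP => v _; exact: ND0.
rewrite !hornerM hornerX !mulf_eq0 !negb_or => /andP[/andP[z0 Dz0]].
rewrite horner_prod prodf_seq_neq0 => /allP bz.
exists (N.[z] / D.[z]); last exact: H.
apply/negP => /bz /=.
by rewrite !hornerE divfK// subrr eqxx.
Qed.
End Densities.

Section Letters3.
Variables (R : realType) (I : eqType) (a b c : I).
Hypothesis abc : uniq [:: a; b; c].

(** The case of three letters in the order [a], [b], [c]: the parameters start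
    with their displacements, and [m1], [m2], [m3] are the monomials for the
    entries [ba], [ca], [cb]. *)
Definition fits_abc (m1 m2 m3 : option (seq nat)) (s : seq (I * R)) (P : seq R) :=
  [/\ sig1 s a = P`_0, sig1 s b = P`_1 & sig1 s c = P`_2] /\
  [/\ sig2 s b a = mono P m1, sig2 s c a = mono P m2 & sig2 s c b = mono P m3].

Let abf : ((a == b) = false) * ((b == a) = false) * ((a == c) = false) *
          ((c == a) = false) * ((b == c) = false) * ((c == b) = false).
Proof.
move: abc; rewrite /= !inE negb_or !andbT => /andP[/andP[ab ac] bc].
by rewrite ![b == a]eq_sym ![c == _]eq_sym; do !split; apply: negbTE.
Qed.

Local Notation var k := (Some [:: k%N]).

Definition fitted m1 m2 m3 (p : seq I) (P : seq R) :=
  exists2 s, unzip1 s = p & fits_abc m1 m2 m3 s P.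

Ltac fit ls :=
  match goal with |- fitted _ _ _ ?p _ => exists (zip p ls) end;
  [by [] | rewrite /fits_abc /= !(eqxx, abf) /mono ?big_cons ?big_nil /=].

Ltac solve_fit := split; split;
  by field; repeat match goal with H : is_true (_ != 0) |- _ => rewrite ?H; clear H end.

(** In each of the following lemmas the second signature of a path of the given
    shape is solved for the step lengths, which are rational functions of the
    parameters. *)
Lemma dense_abacab :
  thick 6 (fitted (var 3) (var 4) (var 5)
             [:: a; b; a; c; a; b]).
Proof.
apply: thick6_generic => x y z p q r x0 y0 z0 p0 q0 r0 yzr.
fit [:: x - p / (y - r / z); y - r / z; p / (y - r / z) - q / z; z; q / z;
  r / z].
solve_fit.
Qed.

Lemma dense_abacba :
  thick 6 (fitted (var 3) (var 4) (var 5)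
             [:: a; b; a; c; b; a]).
Proof.
apply: thick6_generic => x y z p q r x0 y0 z0 p0 q0 r0 yzr.
fit [:: x - (p - r / z * (q / z)) / (y - r / z); y - r / z;
  (p - r / z * (q / z)) / (y - r / z) - q / z; z; r / z; q / z].
solve_fit.
Qed.

Lemma dense_abcaba :
  thick 6 (fitted (var 3) (var 4) (var 5)
             [:: a; b; c; a; b; a]).
Proof.
apply: thick6_generic => x y z p q r x0 y0 z0 p0 q0 r0 yzr.
fit [:: x - q / z; y - r / z; z;
  q / z - (p - (y - r / z) * (q / z)) / (r / z); r / z;
  (p - (y - r / z) * (q / z)) / (r / z)].
solve_fit.
Qed.

Lemma dense_abcacb :
  thick 6 (fitted (var 3) (var 4) (var 5)
             [:: a; b; c; a; c; b]).
Proof.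
apply: thick6_generic => x y z p q r x0 y0 z0 p0 q0 r0 yzr.
fit [:: x - p / (y - r / z); y - r / z; q * (y - r / z) / p; p / (y - r / z);
  z - q * (y - r / z) / p; r / z].
solve_fit.
Qed.

Lemma dense_abcbab :
  thick 6 (fitted (var 3) (var 4) (var 5)
             [:: a; b; c; b; a; b]).
Proof.
apply: thick6_generic => x y z p q r x0 y0 z0 p0 q0 r0 yzr.
fit [:: x - q / z; y - r / z; z; p * z / q - (y - r / z); q / z; y - p * z / q].
solve_fit.
Qed.

Lemma dense_abcbac :
  thick 6 (fitted (var 3) (var 4) (var 5)
             [:: a; b; c; b; a; c]).
Proof.
apply: thick6_generic => x y z p q r x0 y0 z0 p0 q0 r0 yzr.
fit [:: x - p / y; y - r * p / (q * y); q * y / p; r * p / (q * y); p / y;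
  z - q * y / p].
solve_fit.
Qed.

Lemma dense_abc : thick 3 (fitted None None None [:: a; b; c]).
Proof.
apply: thick3_nonzero => x y z x0 y0 z0.
fit [:: x; y; z].
solve_fit.
Qed.

Lemma dense_abcb : thick 4 (fitted None None (var 3) [:: a; b; c; b]).
Proof.
apply: thick4_nonzero => x y z p x0 y0 z0 p0.
fit [:: x; y - p / z; z; p / z].
solve_fit.
Qed.

Lemma dense_abac : thick 4 (fitted (var 3) None None [:: a; b; a; c]).
Proof.
apply: thick4_nonzero => x y z p x0 y0 z0 p0.
fit [:: x - p / y; y; p / y; z].
solve_fit.
Qed.

Lemma dense_babca : thick 5 (fitted (var 3) (var 4) None [:: b; a; b; c; a]).
Proof.
apply: thick5_generic => x y z p q x0 y0 z0 p0 q0 xzq.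
fit [:: (p - y * q / z) / (x - q / z); x - q / z;
  y - (p - y * q / z) / (x - q / z); z; q / z].
solve_fit.
Qed.

Lemma dense_abaca : thick 5 (fitted (var 3) (var 4) None [:: a; b; a; c; a]).
Proof.
apply: thick5_generic => x y z p q x0 y0 z0 p0 q0 xzq.
fit [:: x - p / y; y; p / y - q / z; z; q / z].
solve_fit.
Qed.

Lemma dense_abcac : thick 5 (fitted (var 3) (var 4) None [:: a; b; c; a; c]).
Proof.
apply: thick5_generic => x y z p q x0 y0 z0 p0 q0 xzq.
fit [:: x - p / y; y; q * y / p; p / y; z - q * y / p].
solve_fit.
Qed.

Lemma dense_abca :
  thick 4 (fitted (Some [:: 1; 3]%N) (Some [:: 2; 3]%N) None
             [:: a; b; c; a]).
Proof.
apply: thick4_nonzero => x y z p x0 y0 z0 p0.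
fit [:: x - p; y; z; p].
solve_fit.
Qed.

Lemma dense_abcba :
  thick 5 (fitted (Some [:: 1; 3]%N) (Some [:: 2; 3]%N) (var 4)
             [:: a; b; c; b; a]).
Proof.
apply: thick5_generic => x y z p q x0 y0 z0 p0 q0 xzq.
fit [:: x - p; y - q / z; z; q / z; p].
solve_fit.
Qed.

Lemma dense_acbac :
  thick 5 (fitted (Some [:: 1; 4]%N) (Some [:: 3; 4]%N) (Some [:: 3; 1]%N)
             [:: a; c; b; a; c]).
Proof.
apply: thick5_generic => x y z p q x0 y0 z0 p0 q0 xzq.
fit [:: x - q; p; y; q; z - p].
solve_fit.
Qed.

(** Here the equations for the lengths are quadratic. Rather than solving them,
    one leaves the length [w] of the first [c] free: the entry [cb] is then a
    polynomial in [w] that is not constant. *)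
Lemma dense_abcabc :
  thick 6 (fitted (var 3) (var 4) (var 5)
             [:: a; b; c; a; b; c]).
Proof.
apply: thick6_last => x y z p q x0 y0 z0 p0 q0.
apply: (@thick_rational _ (y *: 'X - (p / q) *: 'X^2) 1) => [||w w0 _].
- exact: oner_neq0.
- move=> v; apply/eqP => /(congr1 (fun Q : {poly R} => Q`_2)).
  rewrite !coefE /= => /eqP; rewrite !mulr0 mulr1 subr0 sub0r oppr_eq0.
  by rewrite mulf_eq0 invr_eq0 (negPf p0) (negPf q0).
have -> : (y *: 'X - (p / q) *: 'X^2).[w] / (1 : {poly R}).[w] =
    y * w - p / q * w ^+ 2 by rewrite !hornerE divr1.
set r := y * w - _.
fit [:: x - q / w; y - r / w; w; q / w; r / w; z - w].
rewrite /r; solve_fit.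
Qed.
End Letters3.

(** * Shapes in three letters *)

Lemma has_shapeE (T : eqType) (w : seq T) (pos neg : seq (seq T)) :
  has_shape w (pos, neg) = has (subseq^~ w) pos && all (fun p => ~~ subseq p w) neg.
Proof. by rewrite /has_shape -all_predC. Qed.

Section ThreeLetters.
Variables (R : realType) (d m : nat) (nu : m.-tuple 'I_d) (a b c : 'I_d).
Hypothesis m_gt0 : (0 < m)%N.
Hypothesis abc : uniq [:: a; b; c].
Hypothesis abc_all : forall i, i \in [:: a; b; c].

(** The shape of the path has to satisfy the relations for all step lengths, but
    density can be checked on a subsequence. *)
Lemma toric_fits_abc n m1 m2 m3 p : (2 < n)%N ->
    all (fun o => all (fun l => (l < n)%N) (odflt [::] o)) [:: m1; m2; m3] ->
    subseq p nu ->
    thick n (fitted (R := R) a b c m1 m2 m3 p) ->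
    (forall s : seq ('I_d * R), unzip1 s = nu ->
       exists2 P, size P = n & fits_abc a b c m1 m2 m3 s P) ->
  toric (axis_variety R nu 2).
Proof.
move=> n2 /and4P[m1n m2n m3n _] pnu tp ex.
move: (abc); rewrite /= !inE negb_or !andbT => /andP[/andP[ab ac] bc].
have abf : ((a == b) = false) * ((b == a) = false) * ((a == c) = false) *
          ((c == a) = false) * ((b == c) = false) * ((c == b) = false).
  by rewrite ![b == a]eq_sym ![c == _]eq_sym; do !split; apply: negbTE.
pose inv (i j : 'I_d) := if (i == b) && (j == a) then m1
  else if (i == c) && (j == a) then m2 else if (i == c) && (j == b) then m3 else None.
have fits s P : fits_abc a b c m1 m2 m3 s P -> fits2 [:: a; b; c] inv s P.
  move=> [[fa fb fc] [fba fca fcb]]; split=> [i|i j].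
    by have := abc_all i; rewrite !inE => /or3P[]/eqP->; rewrite /= !(eqxx, abf).
  have := abc_all i; have := abc_all j; rewrite !inE /inv.
  by move=> /or3P[]/eqP-> /or3P[]/eqP->; rewrite /= !(eqxx, abf).
apply: (@toric_order2 R d m nu m_gt0 [:: a; b; c] n inv) => //.
- move=> i j r; rewrite /inv; case: ifP => _; first by case: (m1) m1n => // ? ? [<-].
  case: ifP => _; first by case: (m2) m2n => // ? ? [<-].
  by case: ifP => // _; case: (m3) m3n => // ? ? [<-].
- by move=> s /ex[P sP /fits fP]; exists P.
- by apply: thick_sub tp => P _ [s sp /fits fP]; exists s; rewrite ?sp.
Qed.

Let ba : b != a. Proof. by apply: contraTneq abc => ->; rewrite /= mem_head. Qed.
Let ca : c != a.
Proof. by apply: contraTneq abc => ->; rewrite /= !inE eqxx orbT. Qed.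
Let cb : c != b.
Proof. by apply: contraTneq abc => ->; rewrite /= !inE eqxx andbF. Qed.

Lemma toric_of_shape3 : has (has_shape nu) (shapes3 a b c) ->
  toric (axis_variety R nu 2).
Proof.
rewrite /shapes3 ![has _ (_ :: _)]/= !has_shapeE.
have none (s : seq ('I_d * R)) i j : i != j -> unzip1 s = nu ->
    ~~ subseq [:: i; j] nu -> sig2 s i j = mono [::] None.
  by move=> ij su ns; apply: sig2_eq0 => //; rewrite su.
have outer (s : seq ('I_d * R)) : unzip1 s = nu ->
    ~~ subseq [:: b; a; b] nu -> ~~ subseq [:: b; a; c] nu ->
    ~~ subseq [:: c; a; b] nu -> ~~ subseq [:: c; a; c] nu ->
    exists u, forall e, e != a -> sig2 s e a = sig1 s e * u.
  move=> su n1 n2 n3 n4; apply: outer_letter => y e ya ea; rewrite su.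
  have := abc_all y; have := abc_all e; rewrite !inE (negPf ya) (negPf ea) /=.
  by move=> /orP[]/eqP-> /orP[]/eqP->.
case/orP => [/andP[/= /[!orbF] + /and4P[nba nca ncb _]]|].
  move=> p; apply: (toric_fits_abc _ _ p (dense_abc abc)) => // s su.
  exists [:: sig1 s a; sig1 s b; sig1 s c] => //.
  by split; split=> //; apply: none.
case/orP => [/andP[/= /[!orbF] + /and3P[nba nca _]]|].
  move=> p; apply: (toric_fits_abc _ _ p (dense_abcb abc)) => // s su.
  exists [:: sig1 s a; sig1 s b; sig1 s c; sig2 s c b] => //.
  split; split=> //; try exact: none.
  by rewrite /mono big_cons big_nil mulr1.
case/orP => [/andP[/= /[!orbF] + /and3P[nca ncb _]]|].
  move=> p; apply: (toric_fits_abc _ _ p (dense_abac abc)) => // s su.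
  exists [:: sig1 s a; sig1 s b; sig1 s c; sig2 s b a] => //.
  split; split=> //; try exact: none.
  by rewrite /mono big_cons big_nil mulr1.
case/orP => [/andP[/= /[!orbF] + /andP[ncb _]]|].
  have ex (s : seq ('I_d * R)) : unzip1 s = nu -> exists2 P : seq R, size P = 5 &
      fits_abc a b c (Some [:: 3]%N) (Some [:: 4]%N) None s P.
    move=> su; exists [:: sig1 s a; sig1 s b; sig1 s c; sig2 s b a; sig2 s c a] => //.
    by split; split=> //; rewrite ?(none s c b)// /mono big_cons big_nil mulr1.
  case/or3P => p.
  - by apply: (toric_fits_abc _ _ p (dense_babca abc)).
  - by apply: (toric_fits_abc _ _ p (dense_abaca abc)).
  - by apply: (toric_fits_abc _ _ p (dense_abcac abc)).
case/orP => [/andP[/= /[!orbF] + /and5P[ncb n1 n2 n3 /andP[n4 _]]]|].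
  move=> p; apply: (toric_fits_abc _ _ p (dense_abca abc)) => // s su.
  have [u uE] := outer s su n1 n2 n3 n4.
  exists [:: sig1 s a; sig1 s b; sig1 s c; u] => //.
  by split; split=> //; rewrite ?(none s c b)// uE// /mono !big_cons big_nil mulr1.
case/orP => [/andP[/= /[!orbF] + /and5P[n1 n2 n3 n4 _]]|].
  move=> p; apply: (toric_fits_abc _ _ p (dense_abcba abc)) => // s su.
  have [u uE] := outer s su n1 n2 n3 n4.
  exists [:: sig1 s a; sig1 s b; sig1 s c; u; sig2 s c b] => //.
  by split; split=> //; rewrite ?uE// /mono !big_cons big_nil mulr1.
case/orP => [/andP[/= /[!orbF] + neg]|].
  move=> p; apply: (toric_fits_abc _ _ p (dense_acbac abc)) => // s su.
  have [||u [v [eba eca ecb]]] := @pivot_letter _ _ s a b c abc.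
  - by rewrite su; apply: (mem_subseq p); rewrite !inE eqxx !orbT.
  - by rewrite su.
  exists [:: sig1 s a; sig1 s b; sig1 s c; u; v] => //.
  by split; split=> //; rewrite /mono !big_cons big_nil mulr1.
rewrite orbF => /andP[+ _] /=.
have ex (s : seq ('I_d * R)) : unzip1 s = nu -> exists2 P : seq R, size P = 6 &
    fits_abc a b c (Some [:: 3]%N) (Some [:: 4]%N) (Some [:: 5]%N) s P.
  move=> su.
  exists [:: sig1 s a; sig1 s b; sig1 s c; sig2 s b a; sig2 s c a; sig2 s c b] => //.
  by split; split=> //; rewrite /mono big_cons big_nil mulr1.
case/orP => [p|]; first exact: (toric_fits_abc _ _ p (dense_abacab abc)).
case/orP => [p|]; first exact: (toric_fits_abc _ _ p (dense_abacba abc)).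
case/orP => [p|]; first exact: (toric_fits_abc _ _ p (dense_abcaba abc)).
case/orP => [p|]; first exact: (toric_fits_abc _ _ p (dense_abcabc abc)).
case/orP => [p|]; first exact: (toric_fits_abc _ _ p (dense_abcacb abc)).
case/orP => [p|]; first exact: (toric_fits_abc _ _ p (dense_abcbab abc)).
by case/orP => [p|//]; exact: (toric_fits_abc _ _ p (dense_abcbac abc)).
Qed.
End ThreeLetters.

(** * Shapes in one and two letters *)

Section TwoLetters.
Variables (R : realType) (d : nat) (a b : 'I_d).
Hypothesis ab : a != b.

Definition fitted3 mp mr ms (p : seq 'I_d) (P : seq R) :=
  exists2 s, unzip1 s = p & fits3 a b mp mr ms s P.

Let abf : ((a == b) = false) * ((b == a) = false).
Proof. by rewrite [b == a]eq_sym (negPf ab). Qed.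

Ltac fit3 ls :=
  match goal with |- fitted3 _ _ _ ?p _ => exists (zip p ls) end;
  [by [] | rewrite /fits3 /= !(eqxx, abf) /mono ?big_cons ?big_nil /=].

Lemma dense3_ab : thick 2 (fitted3 None None None [:: a; b]).
Proof.
apply: thick_sub (thick_neq0 R 2) => -[|x [|y [|//]]] // _ _.
by fit3 [:: x; y]; split; field.
Qed.

Lemma dense3_aba :
  thick 3 (fitted3 (Some [:: 1; 2]%N) (Some [:: 1; 2; 2]%N) (Some [:: 1; 1; 2]%N)
             [:: a; b; a]).
Proof.
apply: thick_sub (thick_neq0 R 3) => -[|x [|y [|u [|//]]]] // _ _.
by fit3 [:: x - u; y; u]; split; field.
Qed.

Lemma dense3_abab :
  thick 4 (fitted3 (Some [:: 2; 3]%N) (Some [:: 2; 3; 3]%N) (Some [:: 2; 2; 3]%N)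
             [:: a; b; a; b]).
Proof.
apply: thick_sub (thick_neq0 R 4) => -[|x [|y [|u [|v [|//]]]]] // _ _.
by fit3 [:: x - v; u; v; y - u]; split; field.
Qed.

(** The product [w] of the third and fourth lengths is left free. The first four
    parameters determine all lengths as rational functions of [w], and then the
    last parameter is a rational function of [w] that is not constant, unless
    [K = 0]. *)
Lemma dense3_ababa :
  thick 5 (fitted3 (Some [:: 2]%N) (Some [:: 3]%N) (Some [:: 4]%N)
             [:: a; b; a; b; a]).
Proof.
apply: (@thick_cofinite _ _ _ [::]) => x _.
apply: (@thick_cofinite _ _ _ [:: 0]) => y; rewrite inE => y0.
apply: (@thick_cofinite _ _ _ [::]) => p _.
apply: (@thick_cofinite _ _ _ [:: p ^+ 2 / y]) => q; rewrite inE => qpy.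
pose K := p ^+ 2 - q * y.
have K0 : K != 0.
  by apply: contraNneq qpy => /eqP; rewrite subr_eq0 => /eqP ->; rewrite mulfK.
apply: (@thick_rational _ ((y * p)%:P * 'X^2 + (y * K)%:P * 'X - (y * p * K)%:P)
          ('X^2 - K%:P)) => [|v|w w0].
- apply/eqP => /(congr1 (fun Q : {poly R} => Q`_2)).
  by rewrite !coefE /= subr0 => /eqP; rewrite oner_eq0.
- (* the denominator is even, so only the linear term of the numerator
     contributes to the difference of the values at 1 and -1 *)
  apply/eqP => /(congr1 (fun Q : {poly R} => Q.[1] - Q.[-1])).
  have -> : forall A B C D : R,
      (A%:P * 'X^2 + B%:P * 'X - C%:P - v *: ('X^2 - D%:P)).[1] -
      (A%:P * 'X^2 + B%:P * 'X - C%:P - v *: ('X^2 - D%:P)).[-1] = 2 * B.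
    by move=> A B C D; rewrite !(hornerexpE, hornerZ); ring.
  by move=> /eqP; rewrite !horner0 subrr !mulf_eq0 pnatr_eq0 (negPf y0) (negPf K0).
rewrite !hornerE => D0.
pose u := (w ^+ 2 - K) / (y * w); pose v := y * w ^+ 2 / (w ^+ 2 - K).
pose t := (p + w) / y.
have qE : q = (p ^+ 2 - K) / y by rewrite /K; field.
fit3 [:: x - t; y - v; u; v; t - u].
rewrite /t /u /v; split; rewrite 1?[in RHS]qE; field; by rewrite ?y0 ?w0 ?D0.
Qed.

End TwoLetters.

Section SmallAlphabets.
Variables (R : realType) (d m : nat) (nu : m.-tuple 'I_d).
Hypothesis m_gt0 : (0 < m)%N.

Lemma mono2 (s : seq R) i j : mono s (Some [:: i; j]) = s`_i * s`_j.
Proof. by rewrite /mono !big_cons big_nil mulr1. Qed.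

Lemma toric_one_letter2 (a : 'I_d) : (forall i, i = a) -> toric (axis_variety R nu 2).
Proof.
move=> ia; apply: (@toric_order2 R d m nu m_gt0 [:: a] 1 (fun _ _ => None)) => //.
- by move=> i; rewrite (ia i) mem_head.
- move=> s _; exists [:: sig1 s a] => //; split=> [i|i j].
    by rewrite (ia i) /= eqxx.
  by rewrite (ia i) (ia j) ltnn.
- apply: thick_sub (thick_neq0 R 1) => -[|x [|//]] // _ _.
  exists [:: (a, x)]; last split=> [i|i j].
  + by rewrite sub1seq (_ : a = tnth nu (Ordinal m_gt0)) ?mem_tnth.
  + by rewrite (ia i) /= eqxx mul1r add0r.
  + by rewrite (ia i) (ia j) ltnn.
Qed.

Lemma toric_one_letter3 (a : 'I_d) : (forall i, i = a) -> toric (axis_variety R nu 3).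
Proof.
move=> ia; pose aaa := [tuple a; a; a].
have allE (v : 3.-tuple 'I_d) : v = aaa.
  apply: val_inj; case: v => [[|i [|j [|k []]]]] //= _.
  by rewrite (ia i) (ia j) (ia k).
have cube (s : seq ('I_d * R)) : 6 * sig3 s a a a = sig1 s a ^+ 3.
  have e2 := sig2_shuffle s a a; have e3 := sig3_shuffle s a a a.
  by rewrite exprSr expr2 -e2 [RHS]mulrDl e3; ring.
pose terms (v : 3.-tuple 'I_d) := [:: ((6 : R), v)].
pose mo (v : 3.-tuple 'I_d) := Some [:: 0; 0; 0]%N.
have sumE (u : 3.-tuple 'I_d -> R) v :
    \sum_(t <- terms v) t.1 * u t.2 = 6 * u aaa.
  by rewrite [v]allE /terms big_cons big_nil addr0.
have good (c : 'rV_m) x : sig1 (steps nu c) a = x -> forall v,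
    \sum_(t <- terms v) t.1 * signature (axis_path nu c) t.2 = mono [:: x] (mo v).
  move=> <- v; rewrite sumE (signature3 nu c m_gt0) cube.
  by rewrite /mono /mo !big_cons big_nil /=; ring.
apply: (@toric_words R d m nu 3 1 terms mo) => //.
- by move=> u u0 v; have := u0 v; rewrite sumE [v]allE; lra.
- by exists aaa.
- by move=> v r [<-].
- by move=> c; exists [:: sig1 (steps nu c) a] => //; exact: good.
apply: thick_sub (thick_neq0 R 1) => -[|x [|//]] // _ _.
have [|s' [/(steps_surj m_gt0)[c <-] s1 _ _]] := @sig_pad R _ [:: (a, x)] nu.
  by rewrite sub1seq (_ : a = tnth nu (Ordinal m_gt0)) ?mem_tnth.
by exists c; apply: good; rewrite s1 /= eqxx mul1r add0r.
Qed.

Section Two.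
Variables a b : 'I_d.
Hypothesis ab : a != b.
Hypothesis ab_all : forall i, (i == a) || (i == b).
Hypothesis nu_shape : has (has_shape nu) (shapes2 a b).

Lemma toric_two_letters2 : toric (axis_variety R nu 2).
Proof.
have ba : b != a by rewrite eq_sym.
have [shape|shape] : (subseq [:: a; b] nu /\ ~~ subseq [:: b; a] nu) \/
    subseq [:: a; b; a] nu.
  move: nu_shape; rewrite /shapes2 ![has _ (_ :: _)]/= !has_shapeE /= !orbF !andbT.
  case/or4P => [/andP[? ?]|/andP[? _]|/andP[p _]|p]; [by left|by right|right..].
  - by apply: subseq_trans p; rewrite /= !eqxx.
  - by apply: subseq_trans p; rewrite /= !eqxx.
- have [p n] := shape.
  apply: (@toric_order2 R d m nu m_gt0 [:: a; b] 2 (fun _ _ => None)) => //.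
  + by move=> i; rewrite !inE ab_all.
  + move=> s su; exists [:: sig1 s a; sig1 s b] => //; split=> [i|i j].
      by have /orP[/eqP->|/eqP->] := ab_all i; rewrite /= !(eqxx, negPf ab).
    have /orP[/eqP->|/eqP->] := ab_all i; have /orP[/eqP->|/eqP->] := ab_all j;
      rewrite /= !(eqxx, negPf ab)// => _.
    by apply: sig2_eq0; rewrite ?su.
  + apply: thick_sub (thick_neq0 R 2) => -[|x [|y [|//]]] // _ _.
    exists [:: (a, x); (b, y)] => //; split=> [i|i j].
      have /orP[/eqP->|/eqP->] := ab_all i;
      by rewrite /= !(eqxx, negPf ab, negPf ba) /=; ring.
    have /orP[/eqP->|/eqP->] := ab_all i; have /orP[/eqP->|/eqP->] := ab_all j;
      rewrite /= !(eqxx, negPf ab, negPf ba)// => _.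
    by rewrite /=; ring.
- pose inv (i j : 'I_d) := if (i == b) && (j == a) then Some [:: 2]%N else None.
  apply: (@toric_order2 R d m nu m_gt0 [:: a; b] 3 inv) => //.
  + by move=> i; rewrite !inE ab_all.
  + by move=> i j r; rewrite /inv; case: ifP => // _ [<-].
  + move=> s su; exists [:: sig1 s a; sig1 s b; sig2 s b a] => //; split=> [i|i j].
      by have /orP[/eqP->|/eqP->] := ab_all i; rewrite /= !(eqxx, negPf ab).
    have /orP[/eqP->|/eqP->] := ab_all i; have /orP[/eqP->|/eqP->] := ab_all j;
      rewrite /inv /= !(eqxx, negPf ab)// => _ /=.
    by rewrite /mono big_cons big_nil mulr1.
  + apply: thick_sub (thick_neq0 R 3) => -[|x [|y [|p [|//]]]] // _ /(_ 1%N isT) /= y0.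
    exists [:: (a, x - p / y); (b, y); (a, p / y)] => //; split=> [i|i j].
      have /orP[/eqP->|/eqP->] := ab_all i;
      by rewrite /= !(eqxx, negPf ab, negPf ba) /=; field.
    have /orP[/eqP->|/eqP->] := ab_all i; have /orP[/eqP->|/eqP->] := ab_all j;
      rewrite /inv /= !(eqxx, negPf ab, negPf ba)// => _ /=.
    by rewrite /mono big_cons big_nil /=; field.
Qed.

Lemma toric_fits3 n mp mr ms p : (1 < n)%N ->
    all (fun o => all (fun l => (l < n)%N) (odflt [::] o)) [:: mp; mr; ms] ->
    subseq p nu ->
    thick n (fitted3 (R := R) a b mp mr ms p) ->
    (forall s : seq ('I_d * R), unzip1 s = nu ->
       exists2 P, size P = n & fits3 a b mp mr ms s P) ->
  toric (axis_variety R nu 3).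
Proof.
move=> n1 /and4P[mpn mrn msn _] pnu tp ex.
apply: (toric_binary3 m_gt0 ab ab_all n1 mpn mrn msn ex).
by apply: thick_sub tp => P _ [s sp fP]; exists s; rewrite ?sp.
Qed.

Lemma toric_two_letters3 : toric (axis_variety R nu 3).
Proof.
have ba : b != a by rewrite eq_sym.
move: nu_shape; rewrite /shapes2 ![has _ (_ :: _)]/= !has_shapeE /= !orbF !andbT.
case/or4P => [/andP[p n]|/andP[p n]|/andP[p n]|p].
- apply: (toric_fits3 _ _ p (dense3_ab ab)) => // s su.
  exists [:: sig1 s a; sig1 s b] => //; split=> //.
  + by apply: sig2_eq0; rewrite ?su.
  + by rewrite (sig3_eq0l _ ba) ?su// mulr0.
  + by rewrite (sig3_eq0r _ ba) ?su// mulr0.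
- apply: (toric_fits3 _ _ p (dense3_aba ab)) => // s su.
  have [|u [v [e1 e2 e3 ub]]] := @alternating4 _ _ s a b ab.
    rewrite su; apply: contraNN n => /(subseq_trans _); apply.
    by rewrite /= !eqxx.
  move: e1 e2 e3; rewrite ub ?su// => e1 e2 e3.
  exists [:: sig1 s a; sig1 s b; v] => //.
  by split=> //; rewrite /mono !big_cons big_nil /= mulr1 ?mulrA.
- apply: (toric_fits3 _ _ p (dense3_abab ab)) => // s su.
  have [|u [v [e1 e2 e3 _]]] := @alternating4 _ _ s a b ab; first by rewrite su.
  exists [:: sig1 s a; sig1 s b; u; v] => //.
  by split=> //; rewrite /mono !big_cons big_nil /= mulr1 ?mulrA.
- apply: (toric_fits3 _ _ p (dense3_ababa ab)) => // s su.
  exists [:: sig1 s a; sig1 s b; sig2 s b a; 2 * sig3 s b a a; 2 * sig3 s b b a] => //.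
  by split=> //; rewrite /mono !big_cons big_nil mulr1.
Qed.
End Two.
End SmallAlphabets.

(** * A word with one repeated letter *)

Section RepeatedLetter.
Variables (R : realType) (d : nat) (j0 : 'I_d).

Let inv (i j : 'I_d) := if j == j0 then Some [:: val i; d] else None.

Let index_enum (i : 'I_d) : index i (enum 'I_d) = i.
Proof. exact: index_enum_ord. Qed.

Let enum_increasing (i j : 'I_d) : (j < i)%N -> ~~ subseq [:: i; j] (enum 'I_d).
Proof.
move=> ji; apply/negP => /(map_subseq val); rewrite val_enum_ord /= => ij.
have := subseq_sorted ltn_trans ij (iota_ltn_sorted 0 d).
by rewrite /= andbT ltnNge (ltnW ji).
Qed.

Lemma fits_repeated (s : seq ('I_d * R)) (b : R) (P : seq R) :
    unzip1 s = enum 'I_d -> P`_d = b ->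
    (forall i, P`_(val i) = sig1 (rcons s (j0, b)) i) ->
  fits2 (enum 'I_d) inv (rcons s (j0, b)) P.
Proof.
move=> se Pd Pi; split=> [i|i j]; first by rewrite index_enum Pi.
rewrite !index_enum => ji; have ij : i != j by rewrite -val_eqE gtn_eqF.
rewrite -cats1 sig2_cat sig2_eq0 ?se ?enum_increasing// /inv.
have [E|jj0] := eqVneq j j0; last by rewrite /= [j0 == j]eq_sym (negPf jj0) /=; ring.
rewrite mono2 Pd Pi -cats1 sig1_cat /= -E eqxx [j == i]eq_sym (negPf ij) /=; ring.
Qed.

(** The parameters are the displacements and the length [b] of the last step.
    For [j < i] the entry [ij] is 0 unless [j] is the repeated letter, in which
    case it is the displacement in direction [i] times [b]; and the step lengths
    are linear functions of the parameters. *)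
Lemma toric_repeated_letter : toric (axis_variety R (rcons_tuple (ord_tuple d) j0) 2).
Proof.
apply: (@toric_order2 R d d.+1 _ isT (enum 'I_d) d.+1 inv).
- by move=> i; rewrite mem_enum.
- by rewrite size_enum_ord.
- move=> i j r; rewrite /inv; case: ifP => // _ [<-] /=.
  by rewrite leqnn andbT ltnS ltnW ?ltn_ord.
- move=> s /=; rewrite -cats1 => /unzip1_catP[s1 [s2 [-> s1E s2E]]].
  have [b ->] : exists b, s2 = [:: (j0, b)].
    by case: s2 s2E => [|[y b] [|//]] //= [->]; exists b.
  rewrite cats1; pose P := [seq sig1 (rcons s1 (j0, b)) i | i <- enum 'I_d].
  have sP : size P = d by rewrite size_map size_enum_ord.
  exists (rcons P b); first by rewrite size_rcons sP.
  apply: fits_repeated => // [|i]; rewrite nth_rcons sP ?ltnn ?eqxx// ltn_ord.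
  by rewrite (nth_map i) ?size_enum_ord ?ltn_ord// nth_ord_enum.
- apply: thick_sub (thick_neq0 R d.+1) => P sP _.
  pose b := P`_d; pose s := [seq (i, P`_(val i) - (j0 == i)%:R * b) | i <- enum 'I_d].
  have sE : unzip1 s = enum 'I_d by rewrite /unzip1 -map_comp map_id.
  exists (rcons s (j0, b)).
    by rewrite /unzip1 map_rcons -/(unzip1 s) sE.
  apply: fits_repeated => // i; rewrite -cats1 sig1_cat sig1_sum big_map big_enum /=.
  rewrite (bigD1 i) //= eqxx big1 => [|k /negPf->]; last by rewrite mul0r.
  by rewrite /=; ring.
Qed.
End RepeatedLetter.

Theorem proposition3p9 (R : realType) :
  (forall (d m : nat) (nu : m.-tuple 'I_d),
     (0 < d)%N -> (forall i : 'I_d, i \in nu) -> (d <= 2)%N ->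
     toric (axis_variety R nu 3)) /\
  (forall (d m : nat) (nu : m.-tuple 'I_d),
     (0 < d)%N -> (forall i : 'I_d, i \in nu) -> (d <= 3)%N ->
     toric (axis_variety R nu 2)) /\
  (forall (d : nat) (j : 'I_d),
     (j.+1 < d)%N ->
     toric (axis_variety R (rcons_tuple (ord_tuple d) j) 2)).
Proof.
have m_gt0 d m (nu : m.-tuple 'I_d) : (0 < d)%N -> (forall i, i \in nu) -> (0 < m)%N.
  by move=> d0 /(_ (Ordinal d0)); case: m nu => // nu; rewrite tuple0.
have one (i : 'I_1) : i = ord0 by exact: ord1.
split; [|split] => [d m nu d0 nu_all d2|d m nu d0 nu_all d3|d j _].
- have m0 := m_gt0 d m nu d0 nu_all.
  case: d d0 d2 nu nu_all => [|[|[|//]]] // _ _ nu nu_all.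
    exact: toric_one_letter3 one.
  have [a [b [ab ab_all shape]]] := classify2 nu_all.
  exact: (toric_two_letters3 R m0 ab ab_all shape).
- have m0 := m_gt0 d m nu d0 nu_all.
  case: d d0 d3 nu nu_all => [|[|[|[|//]]]] // _ _ nu nu_all.
  + exact: toric_one_letter2 one.
  + have [a [b [ab ab_all shape]]] := classify2 nu_all.
    exact: (toric_two_letters2 R m0 ab ab_all shape).
  + have [a [b [c [abc abc_all shape]]]] := classify3 nu_all.
    exact: (@toric_of_shape3 R 3 m nu a b c m0 abc abc_all shape).
- exact: toric_repeated_letter.
Qed.
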